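(* Let $f_0\in C^1_{x,v}(\overline\Omega\times\mathbb{R}^2)$ satisfy the specular reflection condition $f_0(x,v)=f_0(x,R_xv)$ for $x\in\partial\Omega$, $v\in\mathbb{R}^2$. Consider the initial condition $$\Big[\nabla_x f_0(x,v)+\nabla_v f_0(x,v)\frac{(Qv)\otimes(Qv)}{v\cdot n}\Big]R_x=\nabla_x f_0(x,R_xv)+\nabla_v f_0(x,R_xv)\frac{(QR_xv)\otimes(QR_xv)}{R_xv\cdot n},\qquad (x,v)\in\gamma_-,\qquad(\ast)$$ where $n=n(x)$. (i) If $f_0$ satisfies $(\ast)$, then $f(t,x,v):=f_0(X(0;t,x,v),V(0;t,x,v))$ is a unique $C^1_{t,x,v}(\mathbb{R}_+\times\mathcal{I})$ solution of the free transport equation $\partial_t f+v\cdot\nabla_x f=0$ in $\Omega$ with the specular reflection boundary condition $f(t,x,v)=f(t,x,R_xv)$, $x\in\partial\Omega$, and initial datum $f_0$. (ii) If $(\ast)$ holds (for $(x,v)\in\gamma_-$), then the same identity also holds for $(x,v)\in\gamma_+$. (iii) If the initial condition $(\ast)$ does not hold, then $f(t,x,v)$ is not of class $C^1_{t,x,v}$ at time $t$ such that $t^k(t,x,v)=0$ for some $k$.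
   Context: $\Omega=\{x\in\mathbb{R}^2:|x|<1\}$, with outward unit normal $n(x)=x$ on $\partial\Omega$, and $R_x=I-2n(x)\otimes n(x)$ for $x\in\partial\Omega$. $\mathbb{R}_+=[0,\infty)$. Vectors are columns, gradients of scalar functions are row vectors, and $a\otimes b=ab^T$. $Q$ is the counterclockwise rotation of $\mathbb{R}^2$ by $\pi/2$. $\gamma_\pm=\{(x,v)\in\partial\Omega\times\mathbb{R}^2:\pm v\cdot n(x)>0\}$, $\gamma_0=\{(x,v)\in\partial\Omega\times\mathbb{R}^2:v\cdot n(x)=0\}$, $\mathcal{I}=(\overline\Omega\times\mathbb{R}^2)\setminus\gamma_0$. Backward specular characteristics: for $(x,v)\in\mathcal I$, $t_{\mathbf b}(x,v)=\sup\{s\ge0:x-sv\in\Omega\}$ (equal to $0$ if $(x,v)\in\gamma_-$; if $v=0$ there is no bounce) and $x_{\mathbf b}(x,v)=x-t_{\mathbf b}(x,v)v$. Put $(t^0,x^0,v^0)=(t,x,v)$ and, for $k\ge1$, $t^k=t^{k-1}-t_{\mathbf b}(x^{k-1},v^{k-1})$, $x^k=x^{k-1}-t_{\mathbf b}(x^{k-1},v^{k-1})v^{k-1}$, $v^k=R_{x^k}v^{k-1}$. For $s\in(t^{k+1},t^k]$ set $X(s;t,x,v)=x^k-(t^k-s)v^k$ and $V(s;t,x,v)=v^k$.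
   Formalization: In (iii), if (∗) fails, f is shown non-C¹ at some (t,x,v) with t>0 and t^k=0, k≥1, and at every (t,x,v) with t^k=0, k≥1, for which (∗) fails at the bounce point (x^k,v^{k-1}); the claim for all (t,x,v) with t^k=0 is false when (∗) fails only at other bounce points. *)

(* Defs.v *)
From HB Require Import structures.
From mathcomp Require Import all_boot all_order all_algebra.
From mathcomp Require Import all_classical all_reals all_analysis.

Set Implicit Arguments.
Unset Strict Implicit.
Unset Printing Implicit Defensive.

Import Order.TTheory GRing.Theory Num.Theory.
Import numFieldNormedType.Exports.

Local Open Scope classical_set_scope.
Local Open Scope ring_scope.

Section C1.
Context {R : realType} {E : normedModType R}.
Implicit Types (S : set E) (f : E -> R) (p : E).

(* Differentials relative to S, so that boundary points of S are allowed; at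
   interior points of S this is the usual Frechet differential. *)
Definition is_diff_within S f p (L : {linear E -> R}) : Prop :=
  let F := within S (nbhs p) in
  continuous L /\ (fun q => f q - f p - L (q - p)) =o_F (fun q => q - p).

(* C^1 up to the boundary points that belong to S.  E is finite-dimensional in
   all uses, so continuity of Df in each direction is continuity in operator
   norm.  On the sets phase_bar and time_I below, which are locally convex with
   dense interior, Df is determined by f. *)
Definition is_C1_on S f (Df : E -> {linear E -> R}) : Prop :=
  (forall p, S p -> is_diff_within S f p (Df p)) /\
  (forall h : E, {within S, continuous (fun p => Df p h)}).

Definition C1_on S f : Prop := exists Df, is_C1_on S f Df.

Definition C1_at S f p : Prop :=
  exists2 U : set E, nbhs p U & C1_on (S `&` U) f.

End C1.

Section Disk.
Context {R : realType}.
Local Notation vec := 'cV[R]_2.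
Local Notation phase := (vec * vec)%type.
Local Notation tphase := (R * vec * vec)%type.
Implicit Types (x v : vec) (s t : R) (k : nat).

Definition dot (a b : vec) : R := (a^T *m b) 0 0.
Definition tens (a b : vec) : 'M[R]_2 := a *m b^T.

(* The library norm on 'cV[R]_2 is the sup norm: |x| < 1 is the Euclidean
   condition below. *)
Definition Omega : set vec := [set x | Num.sqrt (dot x x) < 1].
Definition bOmega : set vec := closure Omega `\` Omega.

Definition nvec x : vec := x.
Definition reflmx x : 'M[R]_2 := 1%:M - 2 *: tens (nvec x) (nvec x).

(* (a, b) |-> (- b, a) *)
Definition rotQ : 'M[R]_2 := delta_mx 1 0 - delta_mx 0 1.

Definition gamma_plus : set phase :=
  [set p | bOmega p.1 /\ 0 < dot p.2 (nvec p.1)].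
Definition gamma_minus : set phase :=
  [set p | bOmega p.1 /\ dot p.2 (nvec p.1) < 0].
Definition gamma_zero : set phase :=
  [set p | bOmega p.1 /\ dot p.2 (nvec p.1) = 0].

Definition phase_bar : set phase := closure Omega `*` setT.
Definition phase_I : set phase := phase_bar `\` gamma_zero.
Definition time_I : set tphase :=
  [set p | 0 <= p.1.1 /\ phase_I (p.1.2, p.2)].

(* The supremum is taken in [0, +oo]: the added 0 makes it 0 on gamma_minus,
   and it is +oo when x is in Omega and v = 0. *)
Definition t_b x v : \bar R :=
  ereal_sup (0%E |` [set s%:E | s in [set s | 0 <= s /\ Omega (x - s *: v)]]).

(* If t_b = +oo then the next time is -oo, and the junk next position and
   velocity are never used. *)
Definition bounce (c : \bar R * vec * vec) : \bar R * vec * vec :=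
  let: (t, x, v) := c in
  let y := x - fine (t_b x v) *: v in
  ((t - t_b x v)%E, y, reflmx y *m v).

Definition cycle_ k t x v := iter k bounce (t%:E, x, v).
Definition t_ k t x v : \bar R := (cycle_ k t x v).1.1.
Definition x_ k t x v : vec := (cycle_ k t x v).1.2.
Definition v_ k t x v : vec := (cycle_ k t x v).2.

(* The k with t^{k+1} < s <= t^k; there is at most one since t^k is
   nonincreasing in k. *)
Definition bounces s t x v : nat :=
  xget 0%N [set k | (t_ k.+1 t x v < s%:E <= t_ k t x v)%E].

Definition char_X s t x v : vec :=
  let k := bounces s t x v in
  x_ k t x v - (fine (t_ k t x v) - s) *: v_ k t x v.
Definition char_V s t x v : vec := v_ (bounces s t x v) t x v.

Definition transport_sol (f0 : phase -> R) (p : tphase) : R :=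
  let: (t, x, v) := p in f0 (char_X 0 t x v, char_V 0 t x v).

Section Gradients.
Variables (D : phase -> {linear phase -> R}) (p : phase).
Definition grad_x : 'rV[R]_2 := \row_j D p (delta_mx j 0, 0).
Definition grad_v : 'rV[R]_2 := \row_j D p (0, delta_mx j 0).
End Gradients.

Section TimeGradients.
Variables (D : tphase -> {linear tphase -> R}) (p : tphase).
Definition tpart_t : R := D p (1, 0, 0).
Definition tgrad_x : 'rV[R]_2 := \row_j D p (0, delta_mx j 0, 0).
End TimeGradients.

Definition specular0 (f0 : phase -> R) : Prop :=
  forall x v, bOmega x -> f0 (x, v) = f0 (x, reflmx x *m v).

Definition compat_side (D0 : phase -> {linear phase -> R}) x v : 'rV[R]_2 :=
  grad_x D0 (x, v) +
  grad_v D0 (x, v) *m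
    ((dot v (nvec x))^-1 *: tens (rotQ *m v) (rotQ *m v)).

Definition compat_at (D0 : phase -> {linear phase -> R}) x v : Prop :=
  compat_side D0 x v *m reflmx x = compat_side D0 x (reflmx x *m v).

Definition compat_on (G : set phase) (D0 : phase -> {linear phase -> R}) :
  Prop := forall x v, G (x, v) -> compat_at D0 x v.

Definition C1_solution (f0 : phase -> R) (f : tphase -> R) : Prop :=
  [/\ exists2 Df, is_C1_on time_I f Df &
        forall t x v, 0 <= t -> Omega x ->
          tpart_t Df (t, x, v) + (tgrad_x Df (t, x, v) *m v) 0 0 = 0,
      forall t x v, 0 <= t -> phase_I (x, v) -> bOmega x ->
        f (t, x, v) = f (t, x, reflmx x *m v) &
      forall x v, phase_I (x, v) -> f (0, x, v) = f0 (x, v)].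

End Disk.

(* Main.v *)
From HB Require Import structures.
Require Import Defs.
From mathcomp Require Import all_boot all_order all_algebra.
From mathcomp Require Import all_classical all_reals all_analysis.
From mathcomp Require Import ring lra.
Import Order.TTheory GRing.Theory Num.Theory.
Import numFieldNormedType.Exports.
Set Implicit Arguments.
Unset Strict Implicit.
Unset Printing Implicit Defensive.
Local Open Scope classical_set_scope.
Local Open Scope ring_scope.

(** The solution is built from two maps on space-time-velocity points
   q = (t, x, v).  Let T = t_b(x, v) and let z = x - T v be the backward exit
   point.  The free map alpha(q) = (x - t v, v) traces back to time 0, and the
   bounce map beta(q) = (t - T, z, R_z v) traces back to the last collision and
   reflects.  Then f = f0 o alpha on the set [unhit] (t <= T) and f = f o beta
   on the set [reflected] (T <= t); these two relatively closed sets cover the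
   domain and meet in the collision times t = T.  Every point has
   only finitely many collisions after time 0: none if it is at rest, and
   otherwise the travel time between two collisions is a positive constant.
   Hence statements about all points follow by induction along beta
   ([bounce_ind]).

   Smoothness.  Both maps have the form phi(q) - phi(p) = A(p, q)(q - p) with
   A(p, q) linear and continuous; for beta this comes from factoring
   0 = |z'|^2 - |z|^2 = (z' - z).(z' + z), which determines T' - T because
   z.v < 0 at an exit point.  So C^1 regularity passes through f0 o alpha and
   f o beta on each of the two sets ([C1_unhit], [C1_reflected]), and f is C^1
   on the whole domain as soon as the two differentials agree where t = T.

   Matching.  Differentiating f0(x, v) = f0(x, R_x v) in v and along the
   circle ([specular_vel], [specular_tan]) shows that the two differentials
   always agree in the directions tangent to the collision set.  Only one
   transversal direction is left, and the time direction can be taken: there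
   the two differentials agree if and only if

     D_x f0(y, w) w = D_x f0(y, R_y w) (R_y w).

   The compatibility condition is a row vector equation; against the tangent
   Q y it always holds, and against R_y w it is exactly this scalar identity,
   because (Q w).w = 0 removes the velocity terms ([compat_transport]).  The
   scalar identity is symmetric under w <-> R_y w, which is why the condition
   passes from incoming to outgoing velocities ([compat_refl]).

   Converse.  If f is differentiable at a point whose k-th collision happens at
   time 0, then the one-sided time derivatives there are computed from f0 just
   before and just after reflection; they are the two sides of the scalar
   identity up to sign, so their equality is the compatibility condition
   ([bounce_compat]).  When t = 0 no earlier time is available, and the first
   derivative is recovered from two directions that enter the disk.

   Uniqueness.  A solution is constant on each segment of a characteristic
   between collisions (mean value theorem, [solution_ray]) and invariant under
   reflection, so [bounce_ind] identifies it with f. *)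


(** * Coordinates on finite-dimensional normed spaces *)

(** Finite dimension in the form needed for estimates: bounded coordinates
   make a pointwise limit of linear maps uniform on bounded sets.  The property
   is stable under products, which covers all the spaces met here. *)
Definition fin_coords (R : realType) (V : normedModType R) : Prop :=
  exists (n : nat) (e : 'I_n -> V) (c : 'I_n -> V -> R),
    forall h, h = \sum_i c i h *: e i /\ forall i, `|c i h| <= `|h|.

Section FinCoords.
Context {R : realType}.

Lemma fin_coords_real : fin_coords (R : normedModType R).
Proof.
exists 1%N, (fun _ => 1), (fun _ h => h) => h; split=> //.
by rewrite big_ord1 /GRing.scale /= mulr1.
Qed.

Lemma sum_pairl (U V : nmodType) n (F : 'I_n -> U) :
  \sum_i ((F i, 0) : U * V) = (\sum_i F i, 0).
Proof.
apply: (big_ind2 (fun (a : U * V) (b : U) => a = (b, 0))) => // _ b _ b' -> ->.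
by congr pair; rewrite /= addr0.
Qed.

Lemma sum_pairr (U V : nmodType) n (F : 'I_n -> V) :
  \sum_i ((0, F i) : U * V) = (0, \sum_i F i).
Proof.
apply: (big_ind2 (fun (a : U * V) (b : V) => a = (0, b))) => // _ b _ b' -> ->.
by congr pair; rewrite /= addr0.
Qed.

Lemma cV_sum_delta n (h : 'cV[R]_n) : h = \sum_i h i 0 *: delta_mx i 0.
Proof.
by rewrite {1}(matrix_sum_delta h); apply: eq_bigr => i _; rewrite big_ord1.
Qed.

Lemma fin_coords_cV n : fin_coords 'cV[R]_n.
Proof.
exists n, (fun i => delta_mx i 0), (fun i (h : 'cV[R]_n) => h i 0) => h; split.
  exact: cV_sum_delta.
move=> i.
rewrite [leRHS]mx_normrE.
exact: (le_bigmax _ (fun ij : 'I_n * 'I_1 => `|h ij.1 ij.2|) (i, 0)).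
Qed.

Lemma fin_coords_prod (U V : normedModType R) :
  fin_coords U -> fin_coords V -> fin_coords (U * V)%type.
Proof.
move=> [m [e [c ec]]] [n [e' [c' ec']]].
exists (m + n)%N.
exists (fun i => match fintype.split i with inl j => (e j, 0) | inr j => (0, e' j) end).
exists (fun i h => match fintype.split i with inl j => c j h.1 | inr j => c' j h.2 end).
move=> h; split.
  rewrite big_split_ord /=.
  under eq_bigr => i _ do rewrite (fintype.unsplitK (inl i)).
  under [X in _ + X]eq_bigr => i _ do rewrite (fintype.unsplitK (inr i)).
  have -> : \sum_i c i h.1 *: ((e i, 0) : U * V) = (h.1, 0).
    rewrite {2}(ec h.1).1 -sum_pairl; apply: eq_bigr => i _.
    by congr pair; rewrite /= scaler0.
  have -> : \sum_i c' i h.2 *: ((0, e' i) : U * V) = (0, h.2).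
    rewrite {2}(ec' h.2).1 -sum_pairr; apply: eq_bigr => i _.
    by congr pair; rewrite /= scaler0.
  by case: h => a b; congr pair; rewrite /= ?addr0 ?add0r.
move=> i; rewrite prod_normE le_max.
case: fintype.split => j; first by rewrite (ec h.1).2.
by rewrite (ec' h.2).2 orbT.
Qed.
End FinCoords.

(** * Pointwise C^1 regularity relative to a set *)

Section C1Local.
Context {R : realType}.
Implicit Types (U V W : normedModType R).

(** The epsilon form of differentiability within a set, with the continuity of
   [L] left out: it is automatic in finite dimension. *)
Definition diff_at V W (S : set V) (f : V -> W) p (L : V -> W) :=
  forall e : R, 0 < e ->
    \forall q \near within S (nbhs p), `|f q - f p - L (q - p)| <= e * `|q - p|.

(** C^1 regularity at a single point of [S].  Being pointwise, it can be proved
   at one point from what happens at another one, namely its image under a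
   chain rule, and then collected over all points by [is_C1_onP]. *)
Definition C1_near V (S : set V) (f : V -> R) (Df : V -> {linear V -> R}) p :=
  diff_at S f p (Df p) /\
  forall h, Df q h @[q --> within S (nbhs p)] --> Df p h.

Lemma linear_bound V W (L : {linear V -> W}) : fin_coords V ->
  exists2 C : R, 0 < C & forall h, `|L h| <= C * `|h|.
Proof.
move=> [n [e [c ec]]]; exists (1 + \sum_i `|L (e i)|).
  by rewrite ltr_pwDl ?ltr01 ?sumr_ge0.
move=> h; rewrite {1}(ec h).1 linear_sum mulrDl mul1r.
apply: le_trans (ler_norm_sum _ _ _) _.
apply: (@le_trans _ _ ((\sum_i `|L (e i)|) * `|h|)); last by rewrite lerDr.
rewrite mulr_suml; apply: ler_sum => i _.
by rewrite linearZ normrZ mulrC ler_wpM2l ?(ec h).2.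
Qed.

Lemma linear_continuous_fin V W (L : {linear V -> W}) : fin_coords V ->
  continuous L.
Proof.
move=> /(linear_bound L) [C C0 LC]; apply/linear_bounded_continuous.
apply/linear_boundedP; exists C; split; first exact: gtr0_real.
move=> r Cr x; apply: le_trans (LC x) _.
by rewrite ler_wpM2r // ltW.
Qed.

Lemma cvg_linear_unif V W T (F : set_system T) (A : T -> {linear V -> W})
    (B : {linear V -> W}) : Filter F -> fin_coords V ->
  (forall h, A q h @[q --> F] --> B h) ->
  forall e : R, 0 < e -> \forall q \near F, forall h, `|A q h - B h| <= e * `|h|.
Proof.
move=> FF [n [b [c bc]]] AB e e0.
have n1 : 0 < e / (n%:R + 1) by rewrite divr_gt0 // ltr_wpDl.
have H : \forall q \near F, forall i, `|A q (b i) - B (b i)| <= e / (n%:R + 1).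
  apply: filter_forall => i.
  move/cvgrPdist_le: (AB (b i)) => /(_ _ n1); apply: filterS => q.
  by rewrite distrC.
apply: filterS H => q Hq h.
have -> : A q h - B h = \sum_i c i h *: (A q (b i) - B (b i)).
  rewrite {1 2}(bc h).1 (linear_sum (A q)) (linear_sum B) -sumrB.
  by apply: eq_bigr => i _; rewrite (linearZZ (A q)) (linearZZ B) -scalerBr.
apply: le_trans (ler_norm_sum _ _ _) _.
apply: (@le_trans _ _ (\sum_(i < n) (e / (n%:R + 1)) * `|h|)).
  apply: ler_sum => i _; rewrite normrZ mulrC.
  by apply: ler_pM => //; exact: (bc h).2.
rewrite sumr_const card_ord -[leLHS]mulr_natl mulrA ler_wpM2r //.
rewrite mulrCA ger_pMr // ler_pdivrMr ?ltr_wpDl // mul1r lerDl //.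
Qed.

(** Joint continuity of evaluation.  Continuity of a differential is only
   given direction by direction, while the chain rule needs it along a moving
   direction. *)
Lemma cvg_linear_pair V W T (F : set_system T) (A : T -> {linear V -> W})
    (B : {linear V -> W}) (h : T -> V) (k : V) : Filter F -> fin_coords V ->
  (forall h, A q h @[q --> F] --> B h) -> h q @[q --> F] --> k ->
  A q (h q) @[q --> F] --> B k.
Proof.
move=> FF VF AB hk.
have -> : (fun q => A q (h q)) = (fun q => A q (h q - k) + A q k).
  by apply/funext => q; rewrite -linearD subrK.
rewrite -[B k]add0r; apply: cvgD; last exact: AB.
have [C C0 BC] := linear_bound B VF.
have U : \forall q \near F,
    `|A q (h q - k) - B (h q - k)| <= 1 * `|h q - k|.
  by apply: filterS (cvg_linear_unif FF VF AB ltr01) => q; exact.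
apply/cvgr0Pnorm_le => e e0.
have Ce : 0 < e / (1 + C) by rewrite divr_gt0 // addr_gt0.
move/cvgrPdist_le: hk => /(_ _ Ce) hk.
near=> q.
have -> : A q (h q - k) = (A q (h q - k) - B (h q - k)) + B (h q - k).
  by rewrite subrK.
apply: le_trans (ler_normD _ _) _.
apply: (@le_trans _ _ (1 * `|h q - k| + C * `|h q - k|)).
  by apply: lerD => //; near: q.
rewrite -mulrDl mulrC -ler_pdivlMr ?addr_gt0 // distrC.
by near: q.
Unshelve. all: by end_near. Qed.

Lemma is_C1_onP V (S : set V) f Df : fin_coords V ->
  is_C1_on S f Df <-> forall p, S p -> C1_near S f Df p.
Proof.
move=> FV; split=> [[Dd Dc] p Sp|H].
  split; last by move=> h; move/subspace_continuousP: (Dc h); exact.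
  by have [_ /eqoP E] := Dd p Sp.
split=> [p Sp|h].
  split; first exact: linear_continuous_fin.
  by apply/eqoP => e; exact: (H p Sp).1.
by apply/subspace_continuousP => p Sp; exact: (H p Sp).2.
Qed.

(** Gluing: a single candidate differential that works on both pieces works
   on their union, so no description of the interface is needed. *)
Lemma C1_near_setU V (S1 S2 : set V) f Df p :
  C1_near S1 f Df p -> C1_near S2 f Df p -> C1_near (S1 `|` S2) f Df p.
Proof.
move=> [d1 c1] [d2 c2]; split=> [e e0|h P Pp].
  by apply: (@filterS2 _ (nbhs p)) (d1 e e0) (d2 e e0) => q H1 H2 [/H1|/H2].
by apply: (@filterS2 _ (nbhs p)) (c1 h P Pp) (c2 h P Pp) => q H1 H2 [/H1|/H2].
Qed.

Lemma C1_near_local V (S S' : set V) f Df p :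
  (\forall q \near within S (nbhs p), S' q) ->
  C1_near S' f Df p -> C1_near S f Df p.
Proof.
move=> SS [d c]; split=> [e e0|h P Pp].
  by apply: (@filterS2 _ (nbhs p)) (d e e0) SS => q H1 H2 /H2 /H1.
by apply: (@filterS2 _ (nbhs p)) (c h P Pp) SS => q H1 H2 /H2 /H1.
Qed.

Lemma C1_near_eq V (S : set V) f f' (Df Df' : V -> {linear V -> R}) p : S p ->
  (forall q, S q -> f q = f' q) -> (forall q h, S q -> Df q h = Df' q h) ->
  C1_near S f' Df' p -> C1_near S f Df p.
Proof.
move=> Sp ff DD [d c]; split=> [e e0|h].
  apply: (@filterS _ (nbhs p)) (d e e0) => q H Sq.
  by rewrite ff // ff // DD //; exact: H.
rewrite DD //; apply: cvg_trans (c h); apply: near_eq_cvg.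
by apply: filterS (withinT S (nbhs_filter p)) => q Sq; rewrite DD.
Qed.

Lemma cvg_slope V W (S : set V) (phi : V -> W) (A : V -> {linear V -> W}) p :
  fin_coords V -> S p ->
  (\forall q \near within S (nbhs p), phi q - phi p = A q (q - p)) ->
  (forall h, A q h @[q --> within S (nbhs p)] --> A p h) ->
  phi q @[q --> within S (nbhs p)] --> phi p.
Proof.
move=> FV Sp E Ac.
suff : phi q - phi p @[q --> within S (nbhs p)] --> (0 : W).
  by move=> H; apply/subr_cvg0.
rewrite -(linear0 (A p)).
apply: (@cvg_trans _ (A q (q - p) @[q --> within S (nbhs p)])).
  by apply: near_eq_cvg; apply: filterS E => q ->.
apply: cvg_linear_pair => //.
rewrite -(subrr p); apply: cvgB; last exact: cvg_cst.
exact: cvg_within.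
Qed.

(** Chain rule for an inner map given by a slope factorization.  The
   two-point slope [A p q] yields differentiability at [p], its diagonal
   [A q q] is the differential at nearby points. *)
Lemma C1_near_comp U V (S : set U) (S' : set V) f Df (phi : V -> U)
    (A : V -> V -> {linear V -> U}) p :
  fin_coords U -> fin_coords V -> S' p ->
  (forall q, S' q -> S (phi q)) ->
  (\forall q \near within S' (nbhs p), phi q - phi p = A p q (q - p)) ->
  (forall h, A p q h @[q --> within S' (nbhs p)] --> A p p h) ->
  (forall h, A q q h @[q --> within S' (nbhs p)] --> A p p h) ->
  C1_near S f Df (phi p) ->
  C1_near S' (f \o phi) (fun q => Df (phi q) \o A q q) p.
Proof.
move=> FU FV S'p SS E Ac Dc [d c].
have phic := cvg_slope FV S'p E Ac.
have phiS : phi q @[q --> within S' (nbhs p)] --> within S (nbhs (phi p)).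
  move=> P /= HP.
  have := phic _ HP; apply: (@filterS _ (nbhs p)) => q /= H S'q.
  exact: H (SS _ S'q).
split; last first.
  move=> h /=; apply: cvg_linear_pair => // k.
  exact: cvg_comp phiS (c k).
move=> e e0.
have [C C0 AC] := linear_bound (A p p) FV.
have [D D0 DD] := linear_bound (Df (phi p)) FU.
have U1 := cvg_linear_unif _ FV Ac ltr01.
(* The increment of phi is at most (1 + C) |q - p|, so this precision
   leaves half of e for the remainder of f; the other half is for A. *)
have e1 : 0 < e / 2 / (1 + C) by rewrite !divr_gt0 // addr_gt0.
have e2 : 0 < e / 2 / D by rewrite !divr_gt0.
have U2 := cvg_linear_unif _ FV Ac e2.
have dq := phiS _ (d _ e1).
near=> q => /=.
have Eq : phi q - phi p = A p q (q - p) by near: q.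
have dq' : `|f (phi q) - f (phi p) - Df (phi p) (phi q - phi p)|
   <= e / 2 / (1 + C) * `|phi q - phi p| by near: q.
have -> : f (phi q) - f (phi p) - Df (phi p) (A p p (q - p)) =
  (f (phi q) - f (phi p) - Df (phi p) (phi q - phi p)) +
  Df (phi p) (A p q (q - p) - A p p (q - p)).
  by rewrite linearB Eq; ring.
apply: le_trans (ler_normD _ _) _.
rewrite [e]splitr mulrDl lerD //.
  apply: le_trans dq' _.
  rewrite -mulrA ler_wpM2l ?divr_ge0 ?(ltW e0) // mulrC ler_pdivrMr ?addr_gt0 //.
  have -> : phi q - phi p = A p q (q - p) - A p p (q - p) + A p p (q - p).
    by rewrite Eq subrK.
  apply: le_trans (ler_normD _ _) _; rewrite mulrDr mulr1 lerD //.
    rewrite -[leRHS]mul1r.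
    by move: (q - p); near: q; exact: U1.
  by rewrite mulrC AC.
apply: le_trans (DD _) _.
rewrite mulrC -ler_pdivlMr // mulrAC.
by move: (q - p); near: q; exact: U2.
Unshelve. all: by end_near. Qed.

(** The derivative along a curve p + s u(s) whose slope u(s) has a limit.
   The filter is left free so that one-sided and two-sided derivatives are both
   covered. *)
Lemma diff_at_curve V (S : set V) (f : V -> R) p (L : {linear V -> R})
    (F : set_system R) {FF : Filter F} (u : R -> V) (h : V) :
  s @[s --> F] --> (0 : R) -> (\forall s \near F, s != 0) ->
  fin_coords V -> diff_at S f p L ->
  u s @[s --> F] --> h -> (\forall s \near F, S (p + s *: u s)) ->
  s^-1 * (f (p + s *: u s) - f p) @[s --> F] --> L h.
Proof.
move=> s0 sn0 FV d uh Su.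
have Lu : L (u s) @[s --> F] --> L h.
  by apply: (cvg_comp _ _ uh); exact: (@linear_continuous_fin _ _ L FV h).
suff H : s^-1 * (f (p + s *: u s) - f p) - L (u s) @[s --> F] --> (0 : R).
  rewrite -[L h]add0r; apply: (cvg_trans _ (cvgD H Lu)).
  by apply: near_eq_cvg; near=> s => /=; rewrite subrK.
have pc : p + s *: u s @[s --> F] --> p.
  rewrite -[X in _ --> X]addr0 -(scale0r h).
  by apply: cvgD; [exact: cvg_cst|exact: cvgZ].
have pS : p + s *: u s @[s --> F] --> within S (nbhs p).
  move=> P /= HP; have := pc _ HP.
  by apply: filterS2 Su => s /= Ss; apply.
apply/cvgr0Pnorm_le => e e0.
have h1 : 0 < `|h| + 1 by rewrite ltr_wpDl.
have e1 : 0 < e / (`|h| + 1) by rewrite divr_gt0.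
have dd := pS _ (d _ e1).
have ub : \forall s \near F, `|u s| <= `|h| + 1.
  apply: (@cvgr_le _ _ _ _ _ `|h|); [exact: cvg_norm|by rewrite ltrDl].
near=> s.
have sn : s != 0 by near: s.
have sp : 0 < `|s| by rewrite normr_gt0.
have : `|f (p + s *: u s) - f p - L (p + s *: u s - p)| <=
    e / (`|h| + 1) * `|p + s *: u s - p| by near: s.
have -> : p + s *: u s - p = s *: u s by rewrite addrC addKr.
rewrite linearZ normrZ => Hd.
have -> : s^-1 * (f (p + s *: u s) - f p) - L (u s) =
  s^-1 * (f (p + s *: u s) - f p - s *: L (u s)).
  by rewrite [RHS]mulrBr -[_ *: L _]/(s * L (u s)) mulKf.
rewrite normrM normfV mulrC ler_pdivrMr //.
apply: le_trans Hd _.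
rewrite mulrCA [leLHS]mulrC ler_pM2r // -mulrA ger_pMr // ler_pdivrMl // mulr1.
by near: s.
Unshelve. all: by end_near. Qed.

Lemma diff_at_cvg V W (S : set V) (f : V -> W) p (L : {linear V -> W}) :
  fin_coords V -> diff_at S f p L ->
  f q @[q --> within S (nbhs p)] --> f p.
Proof.
move=> FV d; have [C C0 LC] := linear_bound L FV.
have Cp : id @ within S (nbhs p) --> p by exact: cvg_within.
apply/cvgrPdist_le => e e0.
have e1 : 0 < e / (1 + C) by rewrite divr_gt0 // addr_gt0.
move/cvgrPdist_le: Cp => /(_ _ e1) Cp.
have d1 := d _ ltr01.
near=> q.
have dq : `|f q - f p - L (q - p)| <= 1 * `|q - p| by near: q; exact: d1.
rewrite distrC; have -> : f q - f p = f q - f p - L (q - p) + L (q - p).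
  by rewrite subrK.
apply: le_trans (ler_normD _ _) _; apply: le_trans (lerD dq (LC _)) _.
rewrite -mulrDl mulrC -ler_pdivlMr ?addr_gt0 // distrC.
by near: q; exact: Cp.
Unshelve. all: by end_near. Qed.

End C1Local.

(** * The unit disk and the backward exit time *)

Section Plane.
Context {R : realType}.
Local Notation vec := 'cV[R]_2.
Local Notation phase := (vec * vec)%type.
Local Notation tphase := (R * vec * vec)%type.
Implicit Types (x v w y a b : vec) (s t : R).

Lemma dotE a b : dot a b = a 0 0 * b 0 0 + a 1 0 * b 1 0.
Proof.
rewrite /dot mxE big_ord_recl big_ord1 !mxE.
by congr (_ + a _ _ * b _ _); apply/val_inj.
Qed.

Lemma vec2P a b : a 0 0 = b 0 0 -> a 1 0 = b 1 0 -> a = b.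
Proof.
move=> h0 h1; apply/matrixP => i j; rewrite ord1.
case: (unliftP 0 i) => [k|] ->; last exact: h0.
by rewrite ord1; have -> : lift 0 0 = 1 :> 'I_2 by apply/val_inj.
Qed.

Lemma dotC a b : dot a b = dot b a.
Proof. by rewrite !dotE; ring. Qed.
Lemma dotDl a b w : dot (a + b) w = dot a w + dot b w.
Proof. by rewrite !dotE !mxE; ring. Qed.
Lemma dotNl a w : dot (- a) w = - dot a w.
Proof. by rewrite !dotE !mxE; ring. Qed.
Lemma dotZl s a w : dot (s *: a) w = s * dot a w.
Proof. by rewrite !dotE !mxE; ring. Qed.
Lemma dotDr a b w : dot w (a + b) = dot w a + dot w b.
Proof. by rewrite !(dotC w) dotDl. Qed.
Lemma dotNr a w : dot w (- a) = - dot w a.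
Proof. by rewrite !(dotC w) dotNl. Qed.
Lemma dotZr s a w : dot w (s *: a) = s * dot w a.
Proof. by rewrite !(dotC w) dotZl. Qed.
Lemma dot0l w : dot 0 w = 0.
Proof. by rewrite !dotE !mxE; ring. Qed.
Definition dotD := (dotDl, dotDr, dotNl, dotNr, dotZl, dotZr).

Lemma dot_ge0 a : 0 <= dot a a.
Proof. by rewrite dotE; nra. Qed.

Lemma dot_gt0 a : (0 < dot a a) = (a != 0).
Proof.
rewrite lt0r dot_ge0 andbT; congr (~~ _).
apply/eqP/eqP => [|->]; last exact: dot0l.
rewrite dotE => H.
have h0 : a 0 0 = 0 by nra.
have h1 : a 1 0 = 0 by nra.
by apply: vec2P; rewrite mxE.
Qed.

Lemma reflE y v : reflmx y *m v = v - (2 * dot y v) *: y.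
Proof.
rewrite /reflmx /tens /nvec mulmxBl mul1mx -scalemxAl -mulmxA; congr (_ - _).
rewrite -scalerA; congr (_ *: _).
rewrite [y^T *m v]mx11_scalar mul_mx_scalar; congr (_ *: _).
Qed.

Lemma cvg_dot T (F : set_system T) (f g : T -> vec) a b : Filter F ->
  f q @[q --> F] --> a -> g q @[q --> F] --> b ->
  dot (f q) (g q) @[q --> F] --> dot a b.
Proof.
move=> FF fa gb; rewrite dotE.
under eq_fun => q do rewrite dotE.
have C i (h : T -> vec) (c : vec) : h q @[q --> F] --> c -> h q i 0 @[q --> F] --> c i 0.
  move=> hc; apply: (@cvg_comp _ _ _ h (fun m : vec => m i 0) _ _ _ hc).
  exact: coord_continuous.
by apply: cvgD; apply: cvgM; exact: C.
Qed.

Lemma OmegaE x : Omega x <-> dot x x < 1.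
Proof.
rewrite /Omega /=; split => H.
  rewrite -(sqr_sqrtr (dot_ge0 x)).
  by rewrite expr_lte1 // sqrtr_ge0.
by rewrite -sqrtr1 ltr_sqrt // ltr01.
Qed.

Lemma closure_OmegaE x : closure Omega x <-> dot x x <= 1.
Proof.
split=> H; last first.
  have [->|x0] := eqVneq x 0.
    by apply: subset_closure; apply/OmegaE; rewrite dot0l ltr01.
  move=> U Ux.
  have C : (1 - s) *: x @[s --> (0 : R)^'+] --> x.
    have {2}-> : x = (1 - 0) *: x by rewrite subr0 scale1r.
    apply: cvgZ; last exact: cvg_cst.
    apply: cvgB; first exact: cvg_cst.
    exact: cvg_within.
  have near1 : \forall s \near (0 : R)^'+, U ((1 - s) *: x) by exact: C.
  have near2 : \forall s \near (0 : R)^'+, 0 < s < 1.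
    by near=> s; apply/andP; split; near: s;
      [exact: nbhs_right_gt | exact: nbhs_right_lt].
  have [s [Us /andP[s0 s1]]] := filter_ex (filterI near1 near2).
  exists ((1 - s) *: x); split=> //; apply/OmegaE; rewrite !dotD.
  have h1 : (1 - s) * dot x x <= 1 - s by rewrite ger_pMr // subr_gt0.
  have h2 : (1 - s) * ((1 - s) * dot x x) <= (1 - s) * (1 - s).
    by rewrite ler_wpM2l // subr_ge0 ltW.
  by apply: le_lt_trans h2 _; nra.
rewrite leNgt; apply/negP => H1.
have C : dot y y @[y --> x] --> dot x x.
  exact: (@cvg_dot _ (nbhs x) id id x x _ cvg_id cvg_id).
have N : \forall y \near x, 1 < dot y y by exact: (cvgr_gt _ C).
have [y [/OmegaE y1 y2]] := H _ N.
by rewrite ltNge ltW // in y2.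
Unshelve. all: by end_near. Qed.

Lemma bOmegaE x : bOmega x <-> dot x x = 1.
Proof.
split=> [[/closure_OmegaE h1 h2]|h].
  apply/eqP; rewrite eq_le h1 /= leNgt; apply/negP => h3; exact/h2/OmegaE.
split; first by apply/closure_OmegaE; rewrite h.
by move/OmegaE; rewrite h ltxx.
Qed.

Lemma phase_IE x v :
  phase_I (x, v) <-> dot x x <= 1 /\ (dot x x = 1 -> dot x v != 0).
Proof.
split=> [[[/= /closure_OmegaE h _] ng]|[h1 h2]].
  split=> // x1; apply/eqP => xv; apply: ng; split; first exact/bOmegaE.
  by rewrite /= dotC.
split; first by split=> //; exact/closure_OmegaE.
by move=> [/= /bOmegaE /h2 /eqP]; rewrite /nvec dotC.
Qed.

(** A quarter of the discriminant of the equation |x - s v|^2 = 1 in s, whose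
   larger root is [tau]. *)
Definition disc x v : R := dot x v ^+ 2 + (1 - dot x x) * dot v v.
Definition tau x v : R := (dot x v + Num.sqrt (disc x v)) / dot v v.

(** On the boundary the grazing velocities are excluded, and inside the disk
   the product of the two roots is negative. *)
Lemma disc_gt0 x v : phase_I (x, v) -> v != 0 -> 0 < disc x v.
Proof.
move=> /phase_IE [x1 xv] v0; rewrite -dot_gt0 in v0; rewrite /disc.
have [/eqP|x1'] := eqVneq (dot x x) 1.
  move/eqP => e; rewrite e subrr mul0r addr0.
  by rewrite lt0r sqr_ge0 andbT sqrf_eq0 xv.
have : dot x x < 1 by rewrite lt_neqAle x1' x1.
by nra.
Qed.

Section Hit.
Variables (x v : vec).
Hypotheses (xv : phase_I (x, v)) (v0 : v != 0).
Let r := Num.sqrt (disc x v).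
Let T := tau x v.

Let vv : 0 < dot v v. Proof. by rewrite dot_gt0. Qed.
Let r2 : r ^+ 2 = disc x v.
Proof. by rewrite sqr_sqrtr // ltW // disc_gt0. Qed.
Let r0 : 0 < r. Proof. by rewrite sqrtr_gt0 disc_gt0. Qed.
Let Tvv : T * dot v v = dot x v + r.
Proof. by rewrite /T /tau divfK // gt_eqF. Qed.
Let x1 : dot x x <= 1. Proof. by have /phase_IE [] := xv. Qed.

Lemma tau_ge0 : 0 <= T.
Proof.
rewrite /T /tau divr_ge0 // ?(ltW vv) //.
have : dot x v ^+ 2 <= r ^+ 2.
  by rewrite r2 /disc lerDl mulr_ge0 ?(ltW vv) // subr_ge0.
have := r0; rewrite -/r; set c := dot x v; move: r => z; nra.
Qed.

Lemma dot_hit_v : dot (x - T *: v) v = - Num.sqrt (disc x v).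
Proof. by rewrite !dotD Tvv -/r; ring. Qed.

(** The factorization of |v|^2 (|x - s v|^2 - 1) by its two roots. *)
Lemma dot_ray s : dot v v * (dot (x - s *: v) (x - s *: v) - 1) =
  dot v v ^+ 2 * (s - T) * (s - T + 2 * r / dot v v).
Proof.
have vv0 : dot v v != 0 by rewrite gt_eqF.
transitivity ((s * dot v v - T * dot v v) * (s * dot v v - T * dot v v + 2 * r)).
  rewrite Tvv !dotD (dotC v x).
  have -> : (s * dot v v - (dot x v + r)) * (s * dot v v - (dot x v + r) + 2 * r)
    = (s * dot v v - dot x v) ^+ 2 - r ^+ 2 by ring.
  by rewrite r2 /disc; ring.
by field.
Qed.

Lemma hit_boundary : dot (x - T *: v) (x - T *: v) = 1.
Proof.
have := dot_ray T; rewrite subrr mulr0 mul0r => /eqP.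
by rewrite mulf_eq0 gt_eqF //= subr_eq0 => /eqP.
Qed.

(** The other root of the quadratic is nonpositive, so for s > 0 only the
   factor s - T can change sign. *)
Lemma ray_sign s : 0 < s ->
  exists2 c, 0 < c & dot (x - s *: v) (x - s *: v) - 1 = c * (s - T).
Proof.
move=> s0.
have k0 : T * dot v v <= 2 * r.
  rewrite Tvv; have : dot x v ^+ 2 <= r ^+ 2.
    by rewrite r2 /disc lerDl mulr_ge0 ?(ltW vv) // subr_ge0.
  by have := r0; rewrite -/r; move: (dot x v) r => c z; nra.
exists (dot v v * (s - T + 2 * r / dot v v)).
  have : T <= 2 * r / dot v v by rewrite ler_pdivlMr.
  by move=> k; rewrite mulr_gt0 //; lra.
have vv0 : dot v v != 0 by rewrite gt_eqF.
by apply: (mulfI vv0); rewrite dot_ray; ring.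
Qed.

Lemma ray_lt s : 0 < s -> (dot (x - s *: v) (x - s *: v) < 1) = (s < T).
Proof.
move=> /ray_sign [c c0 H].
by rewrite -subr_lt0 H pmulr_rlt0 // subr_lt0.
Qed.

Lemma ray_le s : 0 < s -> (dot (x - s *: v) (x - s *: v) <= 1) = (s <= T).
Proof.
move=> /ray_sign [c c0 H].
by rewrite -subr_le0 H pmulr_rle0 // subr_le0.
Qed.
End Hit.
End Plane.

(** * Bounces along a backward characteristic *)

Section Dynamics.
Context {R : realType}.
Local Notation vec := 'cV[R]_2.
Local Notation phase := (vec * vec)%type.
Local Notation tphase := (R * vec * vec)%type.
Implicit Types (x v w y a b : vec) (s t : R) (p q : tphase) (k n : nat).

Lemma t_b_ge0 x v : (0 <= t_b x v)%E.
Proof. by apply: ereal_sup_ubound; left. Qed.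

(** A particle at rest is inside the disk and never reaches the boundary. *)
Lemma t_b_at_rest x : phase_I (x, 0) -> t_b x 0 = +oo%E.
Proof.
move=> /phase_IE [x1 xx].
have Ox : Omega x.
  apply/OmegaE; rewrite lt_neqAle x1 andbT; apply/eqP => /xx.
  by rewrite dotC dot0l eqxx.
apply/eqyP => A A0; apply: ereal_sup_ubound; right; exists A => //=.
by split; [exact: ltW|rewrite scaler0 subr0].
Qed.

Lemma t_bE x v : phase_I (x, v) -> v != 0 -> t_b x v = (tau x v)%:E.
Proof.
move=> xv v0; apply/eqP; rewrite eq_le; apply/andP; split.
  apply: ge_ereal_sup => _ [->|[s [s0 /OmegaE H] <-]]; rewrite lee_fin.
    exact: tau_ge0.
  move: s0; rewrite le_eqVlt => /predU1P [<-|s0]; first exact: tau_ge0.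
  by apply: ltW; rewrite -(ray_lt xv v0).
rewrite leNgt; apply/negP => H.
have := t_b_ge0 x v; case E : (t_b x v) H => [u| |] //; rewrite lte_fin lee_fin.
move=> uT u0.
have s0 : 0 < (u + tau x v) / 2 by rewrite divr_gt0 // (le_lt_trans u0) // ltr_wpDl.
have sT : (u + tau x v) / 2 < tau x v by rewrite midf_lt.
have us : u < (u + tau x v) / 2 by rewrite midf_lt.
have : (((u + tau x v) / 2)%:E <= t_b x v)%E.
  apply: ereal_sup_ubound; right; exists ((u + tau x v) / 2) => //=.
  by split; [exact: ltW | apply/OmegaE; rewrite ray_lt].
by rewrite E lee_fin leNgt us.
Qed.

Definition hit x v : vec := x - fine (t_b x v) *: v.

(** The real form of [bounce], whose times are extended: correct as long as
   the exit time is finite, that is for moving particles. *)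
Definition beta q : tphase :=
  let z := hit q.1.2 q.2 in (q.1.1 - fine (t_b q.1.2 q.2), z, reflmx z *m q.2).

Definition alpha q : phase := (q.1.2 - q.1.1 *: q.2, q.2).

(** Closed at t = T, as is [reflected]: the two pieces overlap in the
   collision times, where the solution has to be glued. *)
Definition unhit : set tphase :=
  [set q | time_I q /\ (q.1.1%:E <= t_b q.1.2 q.2)%E].
Definition reflected : set tphase :=
  [set q | time_I q /\ (t_b q.1.2 q.2 <= q.1.1%:E)%E].

Lemma reflected_moving q : reflected q -> q.2 != 0.
Proof.
case: q => [[t x] v] [[_ /= xv] H]; apply/eqP => v0.
by move: H; rewrite v0 t_b_at_rest -?v0.
Qed.

Lemma hitE x v : phase_I (x, v) -> v != 0 -> hit x v = x - tau x v *: v.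
Proof. by move=> xv v0; rewrite /hit t_bE. Qed.

Lemma hit_unit x v : phase_I (x, v) -> v != 0 -> dot (hit x v) (hit x v) = 1.
Proof. by move=> xv v0; rewrite hitE // hit_boundary. Qed.

Lemma hit_vel x v : phase_I (x, v) -> v != 0 -> dot (hit x v) v < 0.
Proof.
by move=> xv v0; rewrite hitE // dot_hit_v // oppr_lt0 sqrtr_gt0 disc_gt0.
Qed.

Lemma dot_refl y v : dot y y = 1 -> dot y (reflmx y *m v) = - dot y v.
Proof. by move=> y1; rewrite reflE !dotD y1; ring. Qed.

Lemma refl_speed y v : dot y y = 1 ->
  dot (reflmx y *m v) (reflmx y *m v) = dot v v.
Proof. by move=> y1; rewrite reflE !dotD y1 (dotC v y); ring. Qed.

Lemma reflK y v : dot y y = 1 -> reflmx y *m (reflmx y *m v) = v.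
Proof.
move=> y1; rewrite [LHS]reflE dot_refl // reflE mulrN scaleNr opprK.
by rewrite subrK.
Qed.

Lemma refl_neq0 y v : dot y y = 1 -> v != 0 -> reflmx y *m v != 0.
Proof. by move=> y1; rewrite -!dot_gt0 refl_speed. Qed.

Lemma beta_phase q : phase_I (q.1.2, q.2) -> q.2 != 0 ->
  [/\ phase_I ((beta q).1.2, (beta q).2), (beta q).2 != 0,
     dot (beta q).1.2 (beta q).1.2 = 1 & 0 < dot (beta q).1.2 (beta q).2].
Proof.
move=> xv v0 /=; have z1 := hit_unit xv v0; have zv := hit_vel xv v0.
split=> //.
- apply/phase_IE; rewrite z1 lexx; split=> // _.
  by rewrite dot_refl // oppr_eq0 lt_eqF.
- exact: refl_neq0.
- by rewrite dot_refl // oppr_gt0.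
Qed.

Lemma beta_time_I q : reflected q -> time_I (beta q).
Proof.
move=> rq; have v0 := reflected_moving rq; case: rq => [[t0 xv] H].
have [xv' _ _ _] := beta_phase xv v0; split=> //=.
by move: H; rewrite t_bE // lee_fin subr_ge0.
Qed.

Lemma t_b_boundary x v : phase_I (x, v) -> v != 0 -> dot x x = 1 -> 0 < dot x v ->
  tau x v = 2 * dot x v / dot v v.
Proof.
move=> xv v0 x1 x0; rewrite /tau /disc x1 subrr mul0r addr0 sqrtr_sqr.
by rewrite gtr0_norm //; congr (_ / _); ring.
Qed.

Lemma cycle_beta k q : phase_I (q.1.2, q.2) -> q.2 != 0 ->
  cycle_ k.+1 q.1.1 q.1.2 q.2 = cycle_ k (beta q).1.1 (beta q).1.2 (beta q).2.
Proof.
by move=> xv v0; rewrite /cycle_ iterSr /= /hit t_bE.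
Qed.

Definition tk k q : \bar R := t_ k q.1.1 q.1.2 q.2.

Lemma tk0 q : tk 0 q = q.1.1%:E. Proof. by []. Qed.

Lemma tk1 q : tk 1 q = (q.1.1%:E - t_b q.1.2 q.2)%E. Proof. by []. Qed.

Lemma tk_beta k q : phase_I (q.1.2, q.2) -> q.2 != 0 ->
  tk k.+1 q = tk k (beta q).
Proof. by move=> xv v0; rewrite /tk /t_ cycle_beta. Qed.

Lemma tk_decr k q : (tk k.+1 q <= tk k q)%E.
Proof.
rewrite /tk /t_ /cycle_ iterS; case: (iter _ _ _) => [[t x] v] /=.
by rewrite -[leRHS]sube0 leeB // t_b_ge0.
Qed.

Lemma tk_mono k n q : (k <= n)%N -> (tk n q <= tk k q)%E.
Proof.
move=> /subnKC <-; elim: (n - k)%N => [|m IH]; first by rewrite addn0.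
by rewrite addnS; exact: le_trans (tk_decr _ _) IH.
Qed.

(** From an outgoing boundary point the travel time to the next collision
   is 2 (x.v) / |v|^2, and reflection preserves both x.v and |v|. *)
Lemma tk_outgoing k q : phase_I (q.1.2, q.2) -> q.2 != 0 ->
  dot q.1.2 q.1.2 = 1 -> 0 < dot q.1.2 q.2 ->
  tk k q = (q.1.1 - k%:R * tau q.1.2 q.2)%:E.
Proof.
elim: k q => [|k IH] q xv v0 x1 xv0; first by rewrite tk0 mul0r subr0.
have [xv' v0' x1' xv0'] := beta_phase xv v0.
rewrite tk_beta // IH //.
rewrite [in RHS]t_b_boundary // t_b_boundary //.
have z1 := hit_unit xv v0.
rewrite {2}/beta /= dot_refl //= refl_speed // hitE // dot_hit_v // opprK.
rewrite t_bE // /= t_b_boundary // /disc x1 subrr mul0r addr0.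
rewrite sqrtr_sqr gtr0_norm //; congr (_%:E).
by rewrite -natr1; ring.
Qed.

Lemma tk_neg q : time_I q -> exists k, (tk k q < 0)%E.
Proof.
move=> [t0 xv].
have [H|H] := boolP (q.1.1%:E < t_b q.1.2 q.2)%E.
  by exists 1%N; rewrite tk1 sube_lt0.
have v0 : q.2 != 0.
  by apply: reflected_moving; split; [split|rewrite leNgt].
have [xv' v0' x1' xv0'] := beta_phase xv v0.
have T0 : 0 < tau (beta q).1.2 (beta q).2.
  by rewrite t_b_boundary // divr_gt0 ?mulr_gt0 // dot_gt0.
(* After the first bounce the k-th collision time is affine in k. *)
exists (Num.bound ((beta q).1.1 / tau (beta q).1.2 (beta q).2)).+1.
rewrite tk_beta // tk_outgoing // lte_fin subr_lt0 -ltr_pdivrMr //.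
apply: archi_boundP; rewrite divr_ge0 // ?(ltW T0) //.
by case: (@beta_time_I q) => //; split; [split|rewrite leNgt].
Qed.

(** Induction on the number of collisions, which is finite by [tk_neg]. *)
Lemma bounce_ind (P : tphase -> Prop) :
  (forall q, time_I q -> (q.1.1%:E < t_b q.1.2 q.2)%E -> P q) ->
  (forall q, reflected q -> P (beta q) -> P q) ->
  forall q, time_I q -> P q.
Proof.
move=> P0 PS q Iq; have [k] := tk_neg Iq.
elim: k q Iq => [|k IH] q Iq; first by rewrite tk0 lte_fin ltNge (proj1 Iq).
have [H _|H] := boolP (q.1.1%:E < t_b q.1.2 q.2)%E; first exact: P0.
have rq : reflected q by split=> //; rewrite leNgt.
rewrite (tk_beta _ (proj2 Iq)) ?reflected_moving // => /IH.
by move=> /(_ (beta_time_I rq)); exact: PS.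
Qed.

Definition nbounces q := bounces 0 q.1.1 q.1.2 q.2.

(** The collision times decrease, so at most one index brackets time 0. *)
Lemma nbouncesE k q : (tk k.+1 q < 0 <= tk k q)%E -> nbounces q = k.
Proof.
move=> /andP[k1 k2]; rewrite /nbounces /bounces.
apply: xget_unique; first by rewrite /= k1 k2.
move=> n /= /andP[n1 n2]; apply/eqP; rewrite eqn_leq; apply/andP; split.
  rewrite leqNgt; apply/negP => /(tk_mono q) H.
  by have := lt_le_trans (le_lt_trans H k1) n2; rewrite ltxx.
rewrite leqNgt; apply/negP => /(tk_mono q) H.
by have := lt_le_trans (le_lt_trans H n1) k2; rewrite ltxx.
Qed.

Lemma nbouncesP q : time_I q ->
  (tk (nbounces q).+1 q < 0 <= tk (nbounces q) q)%E.
Proof.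
move=> Iq; suff [k Hk] : exists k, (tk k.+1 q < 0 <= tk k q)%E.
  by rewrite (nbouncesE Hk).
move: q Iq; apply: bounce_ind => q.
  by move=> Iq H; exists 0%N; rewrite tk0 tk1 sube_lt0 // H lee_fin (proj1 Iq).
move=> rq [k Hk]; exists k.+1.
have v0 := reflected_moving rq; have [[_ xv] _] := rq.
by rewrite (tk_beta k.+1 xv) // (tk_beta k xv).
Qed.

Lemma nbounces0 q : time_I q -> (q.1.1%:E < t_b q.1.2 q.2)%E -> nbounces q = 0%N.
Proof.
move=> Iq H; apply: nbouncesE.
by rewrite tk0 tk1 sube_lt0 // H lee_fin (proj1 Iq).
Qed.

Lemma nbouncesS q : reflected q -> nbounces q = (nbounces (beta q)).+1.
Proof.
move=> rq; apply: nbouncesE.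
have v0 := reflected_moving rq; have [[_ xv] _] := rq.
rewrite (tk_beta _.+1 xv) // (tk_beta _ xv) //.
exact/nbouncesP/beta_time_I.
Qed.

Variable f0 : phase -> R.
Local Notation f := (transport_sol f0).

Lemma sol_unhit_lt q : time_I q -> (q.1.1%:E < t_b q.1.2 q.2)%E ->
  f q = f0 (alpha q).
Proof.
case: q => [[t x] v] Iq H.
rewrite /transport_sol /char_X /char_V.
have := nbounces0 Iq H; rewrite /nbounces /= => ->.
by rewrite /x_ /v_ /t_ /cycle_ /= subr0.
Qed.

Lemma sol_beta q : reflected q -> f q = f (beta q).
Proof.
move=> rq; have v0 := reflected_moving rq; have [[_ xv] _] := rq.
have := nbouncesS rq; have := cycle_beta (nbounces (beta q)) xv v0.
case: q {rq xv v0} => [[t x] v]; rewrite /nbounces /transport_sol /=.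
rewrite /char_X /char_V /x_ /v_ /t_ /= => H -> /=.
by rewrite H.
Qed.

Hypothesis f0_specular : specular0 f0.

(** At t = T the definition of [f] already counts the collision; the
   specular condition on [f0] makes both readings agree. *)
Lemma sol_unhit q : unhit q -> f q = f0 (alpha q).
Proof.
move=> [Iq]; rewrite le_eqVlt => /predU1P [E|]; last exact: sol_unhit_lt.
have rq : reflected q by split=> //; rewrite E.
have v0 := reflected_moving rq; have [_ xv] := Iq.
have t0 : q.1.1 = fine (t_b q.1.2 q.2) by rewrite -E.
have [xv' v0' x1' xv0'] := beta_phase xv v0.
rewrite sol_beta // sol_unhit_lt; last 2 first.
- exact: beta_time_I.
- rewrite {1}/beta /= -t0 subrr t_bE // lte_fin t_b_boundary //.
  by rewrite divr_gt0 ?mulr_gt0 // dot_gt0.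
rewrite /alpha {1 2}/beta /= -t0 subrr scale0r subr0.
have -> : q.1.2 - q.1.1 *: q.2 = hit q.1.2 q.2 by rewrite t0.
rewrite -f0_specular //; apply/bOmegaE; exact: hit_unit.
Qed.
End Dynamics.

(** * Difference quotients of the free and bounce maps *)

Section BounceCalculus.
Context {R : realType}.
Local Notation vec := 'cV[R]_2.
Local Notation phase := (vec * vec)%type.
Local Notation tphase := (R * vec * vec)%type.
Implicit Types (x v w y a b : vec) (s t : R) (p q h : tphase).
Local Notation T q := (fine (t_b q.1.2 q.2)).
Local Notation Z q := (hit q.1.2 q.2).

(** The free map is quadratic, so its increments factor exactly; at [q = p]
   the factor is its differential. *)
Definition slope_alpha p q h : phase :=
  (h.1.2 - q.1.1 *: h.2 - h.1.1 *: p.2, h.2).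

Lemma slope_alpha_linear p q : linear (slope_alpha p q).
Proof.
move=> c [[t x] v] [[t' x'] v']; congr pair => /=.
by rewrite -[c *: t]/(c * t); apply: vec2P; rewrite !mxE; ring.
Qed.
HB.instance Definition _ p q := GRing.isLinear.Build R tphase phase _
  (slope_alpha p q) (slope_alpha_linear p q).

(** The quotient (T' - T) / (q - p), obtained by solving
   (z' - z).(z' + z) = 0 for T' - T, where
   z' - z = (x' - x) - T' (v' - v) - (T' - T) v. *)
Definition slope_T p q h : R :=
  dot (Z q + Z p) (h.1.2 - T q *: h.2) / dot (Z q + Z p) p.2.

Definition slope_hit p q h : vec := h.1.2 - T q *: h.2 - slope_T p q h *: p.2.

Definition slope_beta p q h : tphase :=
  (h.1.1 - slope_T p q h, slope_hit p q h,
   h.2 - 2 *: ((dot (slope_hit p q h) q.2 + dot (Z p) h.2) *: Z q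
               + dot (Z p) p.2 *: slope_hit p q h)).

Lemma slope_T_linear p q c h h' :
  slope_T p q (c *: h + h') = c * slope_T p q h + slope_T p q h'.
Proof.
rewrite /slope_T mulrA -mulrDl; congr (_ / _).
rewrite -dotZr -dotDr; congr (dot _ _) => /=.
by move: (fine _) => r; apply: vec2P; rewrite !mxE; ring.
Qed.

Lemma slope_hit_linear p q c h h' :
  slope_hit p q (c *: h + h') = c *: slope_hit p q h + slope_hit p q h'.
Proof.
rewrite /slope_hit slope_T_linear /=.
move: (fine _) (slope_T _ _ _) (slope_T _ _ _) => r r1 r2.
by apply: vec2P; rewrite !mxE; ring.
Qed.

Lemma slope_beta_linear p q : linear (slope_beta p q).
Proof.
move=> c h h'; rewrite /slope_beta slope_T_linear slope_hit_linear.
congr (_, _, _) => /=.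
- rewrite -[c *: h.1.1]/(c * h.1.1).
  by rewrite -[c *: (_ - _)]/(c * (h.1.1 - slope_T p q h)); ring.
- move: (slope_hit _ _ h) (slope_hit _ _ h') (hit _ _) (hit _ _).
  move: h.2 h'.2 p.2 q.2 => u u' v v' k k' z z'.
  rewrite !(dotDl, dotZl) !(dotDr, dotZr).
  move: (dot _ _) (dot _ _) (dot _ _) (dot _ _) (dot _ _) => r1 r2 r3 r4 r5.
  by apply: vec2P; rewrite !mxE; ring.
Qed.
HB.instance Definition _ p q := GRing.isLinear.Build R tphase tphase _
  (slope_beta p q) (slope_beta_linear p q).

Lemma alpha_slope p q : alpha q - alpha p = slope_alpha p q (q - p).
Proof.
case: p q => [[t x] v] [[t' x'] v']; congr pair => /=.
by apply: vec2P; rewrite !mxE; ring.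
Qed.

Lemma ray_diff r r' x x' v v' :
  x' - r' *: v' - (x - r *: v) = x' - x - r' *: (v' - v) - (r' - r) *: v.
Proof. by apply: vec2P; rewrite !mxE; ring. Qed.

Lemma refl_diff z z' v v' :
  reflmx z' *m v' - reflmx z *m v =
  v' - v - 2 *: ((dot (z' - z) v' + dot z (v' - v)) *: z' + dot z v *: (z' - z)).
Proof.
rewrite !reflE !dotD; move: (dot z v) (dot z v') (dot z' v') => r1 r2 r3.
by apply: vec2P; rewrite !mxE; ring.
Qed.

Lemma dot_sum_diff a b : dot a a = 1 -> dot b b = 1 -> dot (b + a) (b - a) = 0.
Proof. by move=> a1 b1; rewrite !dotD a1 b1 (dotC b a); ring. Qed.

(** Both exit points lie on the unit circle, so their difference is
   orthogonal to their sum; this replaces the differentiation of the square root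
   in the closed form of the exit time. *)
Lemma beta_slope p q : dot (Z p) (Z p) = 1 -> dot (Z q) (Z q) = 1 ->
  dot (Z q + Z p) p.2 != 0 -> beta q - beta p = slope_beta p q (q - p).
Proof.
move=> zp zq m0.
have EZ' : Z q - Z p = q.1.2 - p.1.2 - T q *: (q.2 - p.2) - (T q - T p) *: p.2.
  exact: ray_diff.
have ET : T q - T p = slope_T p q (q - p).
  have := dot_sum_diff zp zq; rewrite EZ' dotDr dotNr dotZr => /eqP.
  by rewrite subr_eq0 /slope_T => /eqP ->; rewrite mulfK.
have EZ : Z q - Z p = slope_hit p q (q - p) by rewrite EZ' ET.
rewrite /slope_beta -ET -EZ -[(q - p).2]/(q.2 - p.2) -refl_diff.
rewrite -[(q - p).1.1]/(q.1.1 - p.1.1).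
have dd (a b c d : R) : a - b - (c - d) = a - c - (b - d) by ring.
by rewrite dd.
Qed.

Lemma cvg_pair_nbhs I (F : set_system I) (U V : topologicalType)
    (f : I -> U) (g : I -> V) (a : U) (b : V) : Filter F ->
  f i @[i --> F] --> a -> g i @[i --> F] --> b ->
  (f i, g i) @[i --> F] --> (a, b).
Proof.
by move=> FF fa gb; exact: (@cvg_pair _ _ _ F (nbhs a) (nbhs b)).
Qed.

Section Limits.
Context {I : Type} (F : set_system I) {FF : Filter F}.
Variables (g : I -> tphase) (p : tphase).
Hypothesis gp : g i @[i --> F] --> p.

Lemma cvg_time : (g i).1.1 @[i --> F] --> p.1.1.
Proof.
apply: (@cvg_comp _ _ _ g (fun q : tphase => q.1.1) _ _ _ gp).
apply: (@cvg_comp _ _ _ fst fst); first exact: cvg_fst.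
exact: cvg_fst.
Qed.

Lemma cvg_pos : (g i).1.2 @[i --> F] --> p.1.2.
Proof.
apply: (@cvg_comp _ _ _ g (fun q : tphase => q.1.2) _ _ _ gp).
apply: (@cvg_comp _ _ _ fst snd); first exact: cvg_fst.
exact: cvg_snd.
Qed.

Lemma cvg_vel : (g i).2 @[i --> F] --> p.2.
Proof. by apply: (@cvg_comp _ _ _ g snd _ _ _ gp); exact: cvg_snd. Qed.

Lemma cvg_tau : p.2 != 0 ->
  tau (g i).1.2 (g i).2 @[i --> F] --> tau p.1.2 p.2.
Proof.
move=> v0; rewrite /tau /disc.
apply: cvgM.
  apply: cvgD; first exact: cvg_dot cvg_pos cvg_vel.
  apply: (@cvg_comp _ _ _ _ Num.sqrt); last exact: sqrt_continuous.
  apply: cvgD.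
    apply: cvgM; exact: cvg_dot cvg_pos cvg_vel.
  apply: cvgM; last exact: cvg_dot cvg_vel cvg_vel.
  apply: cvgB; first exact: cvg_cst.
  exact: cvg_dot cvg_pos cvg_pos.
apply: cvgV; first by rewrite gt_eqF // dot_gt0.
exact: cvg_dot cvg_vel cvg_vel.
Qed.
End Limits.

Lemma moving_near p (S : set tphase) : p.2 != 0 ->
  \forall q \near within S (nbhs p), q.2 != 0.
Proof.
move=> v0; apply: (@cvgr_neq0 _ _ _ _ _ (fun q : tphase => q.2) p.2) v0.
by apply: cvg_vel; exact: cvg_within.
Qed.

Lemma cvg_T p (S : set tphase) : S `<=` time_I -> time_I p -> p.2 != 0 ->
  T q @[q --> within S (nbhs p)] --> T p.
Proof.
move=> SI Ip v0; have [_ xv] := Ip.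
rewrite [X in _ --> X](_ : _ = tau p.1.2 p.2); last by rewrite t_bE.
apply: cvg_trans (cvg_tau (cvg_within _ : id @ within S (nbhs p) --> p) v0).
apply: near_eq_cvg; near=> q.
have [_ xvq] : time_I q.
  by apply: SI; near: q; exact: withinT.
rewrite t_bE //; near: q; exact: moving_near.
Unshelve. all: by end_near. Qed.

Section BetaLimits.
Variable p : tphase.
Hypothesis rp : reflected p.
Local Notation F := (within reflected (nbhs p)).
Let v0 := reflected_moving rp.
Let Ip : time_I p := proj1 rp.
Let xv : phase_I (p.1.2, p.2) := proj2 Ip.

Lemma cvg_T_refl : T q @[q --> F] --> T p.
Proof. by apply: cvg_T => // q []. Qed.

Lemma cvg_Z : Z q @[q --> F] --> Z p.
Proof.
have C : id @ F --> p by exact: cvg_within.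
apply: cvgB; first exact: (cvg_pos C).
by apply: cvgZ; [exact: cvg_T_refl | exact: (cvg_vel C)].
Qed.

Lemma beta_slope_near :
  \forall q \near F, beta q - beta p = slope_beta p q (q - p).
Proof.
have M : dot (Z q + Z p) p.2 @[q --> F] --> dot (Z p + Z p) p.2.
  apply: cvg_dot; last exact: cvg_cst.
  by apply: cvgD; [exact: cvg_Z | exact: cvg_cst].
have M0 : dot (Z p + Z p) p.2 != 0.
  have := hit_vel xv v0; rewrite dotDl => H.
  by rewrite lt_eqF //; lra.
near=> q.
have rq : reflected q by near: q; exact: withinT.
apply: beta_slope; first exact: hit_unit.
  apply: hit_unit; last exact: reflected_moving.
  by case: rq => [[]].
near: q; exact: cvgr_neq0 M0.
Unshelve. all: by end_near. Qed.

Lemma cvg_slope_beta (g : tphase -> tphase) h :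
  (g q).2 @[q --> F] --> p.2 -> Z (g q) @[q --> F] --> Z p ->
  slope_beta (g q) q h @[q --> F] --> slope_beta p p h.
Proof.
move=> gv gz.
have C : id @ F --> p by exact: cvg_within.
have Cv := cvg_vel C.
have cT : slope_T (g q) q h @[q --> F] --> slope_T p p h.
  have cm : Z q + Z (g q) @[q --> F] --> Z p + Z p by apply: cvgD => //; exact: cvg_Z.
  apply: cvgM.
    apply: cvg_dot cm _; apply: cvgB; first exact: cvg_cst.
    by apply: cvgZ; [exact: cvg_T_refl | exact: cvg_cst].
  apply: cvgV; last exact: cvg_dot cm gv.
  have := hit_vel xv v0; rewrite dotDl => H.
  by rewrite lt_eqF //; lra.
have cz : slope_hit (g q) q h @[q --> F] --> slope_hit p p h.
  apply: cvgB; last exact: cvgZ cT gv.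
  apply: cvgB; first exact: cvg_cst.
  by apply: cvgZ; [exact: cvg_T_refl | exact: cvg_cst].
rewrite /slope_beta; apply: cvg_pair_nbhs.
  by apply: cvg_pair_nbhs => //; apply: cvgB => //; exact: cvg_cst.
apply: cvgB; first exact: cvg_cst.
apply: cvgZ; first exact: cvg_cst.
apply: cvgD; last by apply: cvgZ cz; exact: cvg_dot.
apply: cvgZ; last exact: cvg_Z.
apply: cvgD; first exact: cvg_dot cz Cv.
by apply: cvg_dot => //; exact: cvg_cst.
Qed.
End BetaLimits.
End BounceCalculus.

(** * The compatibility condition as a scalar identity *)

(** Both values are limits of the same difference quotients.  This compares
   differentials at different points, and of functions on different spaces. *)
Lemma diff_at_curve_eq (R : realType) (V V' : normedModType R)
    (S : set V) (S' : set V') (f : V -> R) (f' : V' -> R) p p'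
    (L : {linear V -> R}) (L' : {linear V' -> R})
    (u : R -> V) (u' : R -> V') h h' :
  fin_coords V -> fin_coords V' ->
  diff_at S f p L -> diff_at S' f' p' L' ->
  u s @[s --> 0^'+] --> h -> u' s @[s --> 0^'+] --> h' ->
  (\forall s \near 0^'+, S (p + s *: u s)) ->
  (\forall s \near 0^'+, S' (p' + s *: u' s)) ->
  (\forall s \near 0^'+, f (p + s *: u s) - f p = f' (p' + s *: u' s) - f' p') ->
  L h = L' h'.
Proof.
move=> FV FV' d d' uh uh' Su Su' E.
have s0 : (s : R) @[s --> 0^'+] --> (0 : R) by exact: cvg_within.
have sn0 : \forall s \near (0 : R)^'+, s != 0.
  by apply: filterS (nbhs_right_gt 0) => s; exact: lt0r_neq0.
have C : s^-1 * (f (p + s *: u s) - f p) @[s --> (0:R)^'+] --> L h.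
  exact: diff_at_curve s0 sn0 FV d uh Su.
have C' : s^-1 * (f' (p' + s *: u' s) - f' p') @[s --> (0:R)^'+] --> L' h'.
  exact: diff_at_curve s0 sn0 FV' d' uh' Su'.
have C2 : s^-1 * (f (p + s *: u s) - f p) @[s --> (0:R)^'+] --> L' h'.
  apply: cvg_trans C'; apply: near_eq_cvg.
  by apply: filterS E => s ->.
exact: (cvg_unique _ C C2).
Qed.

Section Compat.
Context {R : realType}.
Local Notation vec := 'cV[R]_2.
Local Notation phase := (vec * vec)%type.
Implicit Types (x v w y a b : vec) (s t : R).

Lemma fin_coords_phase : fin_coords phase.
Proof. by apply: fin_coords_prod; exact: fin_coords_cV. Qed.

Lemma rotQ0 y : (rotQ *m y) 0 0 = - y 1 0.
Proof.
rewrite /rotQ mxE big_ord_recl big_ord1 !mxE /=.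
have -> : lift 0 0 = 1 :> 'I_2 by apply/val_inj.
rewrite ?eqxx /=; ring.
Qed.

Lemma rotQ1 y : (rotQ *m y) 1 0 = y 0 0.
Proof.
rewrite /rotQ mxE big_ord_recl big_ord1 !mxE /=.
have -> : lift 0 0 = 1 :> 'I_2 by apply/val_inj.
rewrite ?eqxx /=; ring.
Qed.

Lemma dot_rotQ_rotQ a b : dot (rotQ *m a) (rotQ *m b) = dot a b.
Proof. by rewrite !dotE !rotQ0 !rotQ1; ring. Qed.

Lemma dot_rotQ a : dot (rotQ *m a) a = 0.
Proof. by rewrite !dotE !rotQ0 !rotQ1; ring. Qed.

Lemma tangentE y k : dot y y = 1 -> dot y k = 0 ->
  k = dot (rotQ *m y) k *: (rotQ *m y).
Proof.
rewrite !dotE rotQ0 rotQ1 => e1 e2.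
have aux (a b c d : R) : a * a + b * b = 1 -> a * c + b * d = 0 ->
    c = (- b * c + a * d) * (- b) /\ d = (- b * c + a * d) * a.
  move=> h1 h2; split.
    have -> : (- b * c + a * d) * (- b) = c * (a * a + b * b) - a * (a * c + b * d).
      by ring.
    by rewrite h1 h2; ring.
  have -> : (- b * c + a * d) * a = d * (a * a + b * b) - b * (a * c + b * d).
    by ring.
  by rewrite h1 h2; ring.
have [k0 k1] := aux _ _ _ _ e1 e2.
by apply: vec2P; rewrite [RHS]mxE ?rotQ0 ?rotQ1.
Qed.

Section LinearAlgebra.
Variables (L L' : {linear phase -> R}) (y w : vec).
Local Notation Qy := (rotQ *m y).
Local Notation refl := (reflmx y).
Local Notation tangent_turn k := (- 2 *: (dot k w *: y + dot y w *: k)).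
Hypotheses (y1 : dot y y = 1) (yw : dot y w != 0).
Hypothesis vel_eq : forall k, L (0, k) = L' (0, refl *m k).
Hypothesis tan_eq : L (Qy, 0) = L' (Qy, tangent_turn Qy).

(** The vectors [w] and [Q y] span the plane because [w] is not
   tangent, so the three hypotheses determine the differential.  The argument
   of [L'] is the differential of the local map that crosses the boundary and
   reflects. *)
Lemma reflected_differential : L (w, 0) = L' (refl *m w, 0) ->
  forall a b (c := dot y a / dot y w) (k := a - c *: w),
  L (a, b) = L' (refl *m a, refl *m b + tangent_turn k).
Proof.
move=> trans_eq a b c k.
have yk : dot y k = 0 by rewrite /k dotDr dotNr dotZr /c divfK ?subrr.
have ka : a = c *: w + k by rewrite /k addrC subrK.
have kQ : k = dot Qy k *: Qy by exact: tangentE.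
have EL : (a, b) = c *: (w, 0) + (dot Qy k *: (Qy, 0) + (0, b)) :> phase.
  congr pair => /=; first by rewrite addr0 -kQ -ka.
  by rewrite !scaler0 !add0r.
have ER : (refl *m a, refl *m b + tangent_turn k) =
    c *: (refl *m w, 0) +
    (dot Qy k *: (Qy, tangent_turn Qy) + (0, refl *m b)) :> phase.
  congr pair => /=.
    rewrite {1}ka addr0 -kQ mulmxDr -scalemxAr; congr (_ + _).
    by rewrite reflE yk mulr0 scale0r subr0.
  rewrite scaler0 add0r addrC; congr (_ + _).
  rewrite {1 2}kQ dotZl.
  by apply: vec2P; rewrite !mxE; ring.
have lin (M : {linear phase -> R}) r r' u u' z :
    M (r *: u + (r' *: u' + z)) = r * M u + (r' * M u' + M z).
  by rewrite !linearD !linearZ.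
by rewrite EL ER !lin trans_eq tan_eq vel_eq.
Qed.
End LinearAlgebra.

Lemma row_eq2 (u u' : 'rV[R]_2) a b :
  a 0 0 * b 1 0 - a 1 0 * b 0 0 != 0 ->
  (u *m a) 0 0 = (u' *m a) 0 0 -> (u *m b) 0 0 = (u' *m b) 0 0 -> u = u'.
Proof.
move=> ab; have E (r : 'rV[R]_2) c : (r *m c) 0 0 = dot r^T c.
  by rewrite /dot trmxK.
rewrite !E !dotE !mxE => ea eb.
have h (r0 r1 r0' r1' a0 a1 b0 b1 : R) : a0 * b1 - a1 * b0 != 0 ->
    r0 * a0 + r1 * a1 = r0' * a0 + r1' * a1 ->
    r0 * b0 + r1 * b1 = r0' * b0 + r1' * b1 -> r0 = r0' /\ r1 = r1'.
  move=> d e1 e2; split; apply: (mulIf d).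
    have -> : r0 * (a0 * b1 - a1 * b0) =
      (r0 * a0 + r1 * a1) * b1 - (r0 * b0 + r1 * b1) * a1 by ring.
    by rewrite e1 e2; ring.
  have -> : r1 * (a0 * b1 - a1 * b0) =
      (r0 * b0 + r1 * b1) * a0 - (r0 * a0 + r1 * a1) * b0 by ring.
  by rewrite e1 e2; ring.
have [h0 h1] := h _ _ _ _ _ _ _ _ ab ea eb.
by apply: trmx_inj; apply: vec2P; rewrite !mxE.
Qed.

Section Side.
Variable D0 : phase -> {linear phase -> R}.

Lemma compat_sideE y w a : (compat_side D0 y w *m a) 0 0 =
  D0 (y, w) (a, ((dot w y)^-1 * dot (rotQ *m w) a) *: (rotQ *m w)).
Proof.
have gx b : (grad_x D0 (y, w) *m b) 0 0 = D0 (y, w) (b, 0).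
  have -> : (b, 0) = \sum_i b i 0 *: (delta_mx i 0, 0) :> phase.
    rewrite {1}(cV_sum_delta b) -sum_pairl; apply: eq_bigr => i _.
    by congr pair; rewrite /= scaler0.
  rewrite linear_sum mxE; apply: eq_bigr => i _.
  by rewrite linearZ mxE [RHS]mulrC.
have gv b : (grad_v D0 (y, w) *m b) 0 0 = D0 (y, w) (0, b).
  have -> : (0, b) = \sum_i b i 0 *: (0, delta_mx i 0) :> phase.
    rewrite {1}(cV_sum_delta b) -sum_pairr; apply: eq_bigr => i _.
    by congr pair; rewrite /= scaler0.
  rewrite linear_sum mxE; apply: eq_bigr => i _.
  by rewrite linearZ mxE [RHS]mulrC.
rewrite /compat_side mulmxDl mxE gx -mulmxA gv -linearD; congr (D0 _ _).
congr pair => /=; first by rewrite addr0.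
rewrite add0r -scalemxAl -scalerA; congr (_ *: _).
by rewrite /tens -mulmxA [_^T *m a]mx11_scalar mul_mx_scalar.
Qed.

Hypothesis vel_eq : forall y w k, dot y y = 1 ->
  D0 (y, w) (0, k) = D0 (y, reflmx y *m w) (0, reflmx y *m k).
Hypothesis tan_eq : forall y w, dot y y = 1 ->
  D0 (y, w) (rotQ *m y, 0) = D0 (y, reflmx y *m w)
   (rotQ *m y, - 2 *: (dot (rotQ *m y) w *: y + dot y w *: (rotQ *m y))).

(** The row equation is tested against the basis [Q y], [R_y w].
   Against [Q y] it is a consequence of the two specular derivatives; against
   [R_y w] the velocity terms drop out since [(Q w).w = 0]. *)
Lemma compat_transport y w : dot y y = 1 -> dot y w != 0 ->
  compat_at D0 y w <->
  D0 (y, w) (w, 0) = D0 (y, reflmx y *m w) (reflmx y *m w, 0).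
Proof.
move=> y1 yw; rewrite /compat_at.
have Ew : (compat_side D0 y w *m reflmx y *m (reflmx y *m w)) 0 0 =
    D0 (y, w) (w, 0).
  by rewrite -mulmxA reflK // compat_sideE dot_rotQ mulr0 scale0r.
have ERw : (compat_side D0 y (reflmx y *m w) *m (reflmx y *m w)) 0 0 =
    D0 (y, reflmx y *m w) (reflmx y *m w, 0).
  by rewrite compat_sideE dot_rotQ mulr0 scale0r.
split=> [E|E]; first by rewrite -Ew -ERw E.
apply: (@row_eq2 _ _ (rotQ *m y) (reflmx y *m w)); last by rewrite Ew ERw.
  rewrite rotQ0 rotQ1.
  have -> : - y 1 0 * (reflmx y *m w) 1 0 - y 0 0 * (reflmx y *m w) 0 0 =
     - dot y (reflmx y *m w) by rewrite dotE; ring.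
  by rewrite dot_refl // opprK.
have RQ : reflmx y *m (rotQ *m y) = rotQ *m y.
  by rewrite reflE dotC dot_rotQ mulr0 scale0r subr0.
rewrite -mulmxA RQ !compat_sideE !dot_rotQ_rotQ.
rewrite mulVf ?scale1r; last by rewrite dotC.
rewrite mulVf ?scale1r; last by rewrite dotC dot_refl // oppr_eq0.
have -> : (rotQ *m y, rotQ *m w) = (rotQ *m y, 0) + (0, rotQ *m w) :> phase.
  by congr pair; rewrite /= ?addr0 ?add0r.
rewrite linearD tan_eq // vel_eq // -linearD; congr (D0 _ _).
congr pair => /=; first by rewrite addr0.
have aD (a b : vec) i : (a + b) i 0 = a i 0 + b i 0 by rewrite mxE.
have aN (a : vec) i : (- a) i 0 = - a i 0 by rewrite mxE.
have aZ c (a : vec) i : (c *: a) i 0 = c * a i 0 by rewrite mxE.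
by apply: vec2P; rewrite !(reflE, aD, aN, aZ, rotQ0, rotQ1, dotE); ring.
Qed.
End Side.
End Compat.

(** * Derivatives of the specular reflection condition *)

Section SpecularDerivatives.
Context {R : realType}.
Local Notation vec := 'cV[R]_2.
Local Notation phase := (vec * vec)%type.
Local Notation tphase := (R * vec * vec)%type.
Implicit Types (x v w y a b : vec) (s t : R) (p q : tphase).
Variables (f0 : phase -> R) (D0 : phase -> {linear phase -> R}).
Hypotheses (f0_C1 : is_C1_on phase_bar f0 D0) (f0_spec : specular0 f0).

Lemma datum_C1_near z : phase_bar z -> C1_near phase_bar f0 D0 z.
Proof. by move/(is_C1_onP _ _ _ fin_coords_phase): f0_C1; apply. Qed.

Lemma phase_bar_unit y w : dot y y = 1 -> phase_bar (y, w).
Proof. by move=> y1; split=> //; apply/closure_OmegaE; rewrite /= y1. Qed.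

Lemma specular_vel y w k : dot y y = 1 ->
  D0 (y, w) (0, k) = D0 (y, reflmx y *m w) (0, reflmx y *m k).
Proof.
move=> y1; have yb : bOmega y by exact/bOmegaE.
have E s (a b : vec) : (y, a) + s *: (0, b) = (y, a + s *: b) :> phase.
  by congr pair; rewrite /= scaler0 addr0.
apply: (@diff_at_curve_eq _ _ _ phase_bar phase_bar f0 f0 (y, w)
  (y, reflmx y *m w) _ _ (fun _ => (0, k)) (fun _ => (0, reflmx y *m k))).
- exact: fin_coords_phase.
- exact: fin_coords_phase.
- exact: (datum_C1_near (phase_bar_unit w y1)).1.
- exact: (datum_C1_near (phase_bar_unit (reflmx y *m w) y1)).1.
- exact: cvg_cst.
- exact: cvg_cst.
- by near=> s; rewrite E; exact: phase_bar_unit.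
- by near=> s; rewrite E; exact: phase_bar_unit.
- near=> s; rewrite !E scalemxAr -mulmxDr.
  by rewrite [f0 (y, w)]f0_spec // [f0 (y, w + _)]f0_spec.
Unshelve. all: by end_near. Qed.

(** The specular condition is differentiated along the rational
   parametrization of the unit circle ((1 - s^2) y + 2 s Q y) / (1 + s^2), which
   has velocity 2 Q y at s = 0. *)
Lemma specular_tan y w : dot y y = 1 ->
  D0 (y, w) (rotQ *m y, 0) = D0 (y, reflmx y *m w)
   (rotQ *m y, - 2 *: (dot (rotQ *m y) w *: y + dot y w *: (rotQ *m y))).
Proof.
move=> y1.
set Qy := rotQ *m y.
pose e s : vec := (1 + s ^+ 2)^-1 *: (2 *: Qy - (2 * s) *: y).
pose k s : vec := - 2 *: (dot (e s) w *: (y + s *: e s) + dot y w *: e s).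
have p2 s : 1 + s ^+ 2 != 0 by rewrite gt_eqF // ltr_wpDr ?sqr_ge0.
have c1 s : dot (y + s *: e s) (y + s *: e s) = 1.
  rewrite /e !dotD y1 (dotC y Qy) dot_rotQ dot_rotQ_rotQ y1.
  by field; exact: p2.
have ck s : reflmx y *m w + s *: k s = reflmx (y + s *: e s) *m w.
  rewrite /k; move: (e s) => u; rewrite !reflE !dotD.
  by move: (dot y w) (dot u w) => r r'; apply: vec2P; rewrite !mxE; ring.
have s0 : (s : R) @[s --> 0^'+] --> (0 : R) by exact: cvg_within.
have ec : e s @[s --> 0^'+] --> 2 *: Qy.
  have -> : 2 *: Qy = (1 + 0 ^+ 2)^-1 *: (2 *: Qy - (2 * 0) *: y).
    by rewrite expr0n /= addr0 invr1 scale1r mulr0 scale0r subr0.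
  apply: cvgZ.
    apply: cvgV; first exact: p2.
    apply: cvgD; first exact: cvg_cst.
    by rewrite [X in _ --> X]expr2; under eq_fun do rewrite expr2; exact: cvgM.
  apply: cvgB; first exact: cvg_cst.
  apply: cvgZ; last exact: cvg_cst.
  by apply: cvgM => //; exact: cvg_cst.
have kc : k s @[s --> 0^'+] --> 2 *: (- 2 *: (dot Qy w *: y + dot y w *: Qy)).
  have -> : 2 *: (- 2 *: (dot Qy w *: y + dot y w *: Qy)) =
    - 2 *: (dot (2 *: Qy) w *: (y + 0 *: (2 *: Qy)) + dot y w *: (2 *: Qy)).
    rewrite dotZl scale0r addr0 !scalerDr !scalerA.
    by congr (_ *: _ + _ *: _); ring.
  apply: cvgZ; first exact: cvg_cst.
  apply: cvgD; last by apply: cvgZ; first exact: cvg_cst.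
  apply: cvgZ; first by apply: cvg_dot => //; exact: cvg_cst.
  by apply: cvgD; [exact: cvg_cst|exact: cvgZ].
have H : D0 (y, w) (2 *: Qy, 0) = D0 (y, reflmx y *m w)
   (2 *: Qy, 2 *: (- 2 *: (dot Qy w *: y + dot y w *: Qy))).
  have E s (a : vec) : (y, a) + s *: (e s, 0) = (y + s *: e s, a) :> phase.
    by congr pair; rewrite /= scaler0 addr0.
  have E' s (a : vec) : (y, a) + s *: (e s, k s) =
     (y + s *: e s, a + s *: k s) :> phase by [].
  apply: (@diff_at_curve_eq _ _ _ phase_bar phase_bar f0 f0 (y, w)
    (y, reflmx y *m w) _ _ (fun s => (e s, 0)) (fun s => (e s, k s))).
  - exact: fin_coords_phase.
  - exact: fin_coords_phase.
  - exact: (datum_C1_near (phase_bar_unit w y1)).1.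
  - exact: (datum_C1_near (phase_bar_unit (reflmx y *m w) y1)).1.
  - by apply: cvg_pair_nbhs => //; exact: cvg_cst.
  - exact: cvg_pair_nbhs.
  - by near=> s; rewrite E; exact: phase_bar_unit.
  - by near=> s; rewrite E'; exact: phase_bar_unit.
  - near=> s; rewrite E E' ck.
    rewrite [f0 (y, w)]f0_spec; last exact/bOmegaE.
    by rewrite [f0 (_, w)]f0_spec //; apply/bOmegaE.
apply: (@mulfI _ 2) => //.
have Z (L : {linear phase -> R}) z : 2 * L z = L (2 *: z) by rewrite linearZ.
rewrite !Z; move: H; congr (_ = _); congr (D0 _ _); congr pair.
by rewrite /= scaler0.
Unshelve. all: by end_near. Qed.

Lemma compat_transport_datum y w : dot y y = 1 -> dot y w != 0 ->
  compat_at D0 y w <->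
  D0 (y, w) (w, 0) = D0 (y, reflmx y *m w) (reflmx y *m w, 0).
Proof.
apply: compat_transport => *; [exact: specular_vel|exact: specular_tan].
Qed.

Lemma compat_refl y w : dot y y = 1 -> dot y w != 0 ->
  compat_at D0 y w -> compat_at D0 y (reflmx y *m w).
Proof.
move=> y1 yw /(compat_transport_datum y1 yw) H.
apply/compat_transport_datum => //; first by rewrite dot_refl // oppr_eq0.
by rewrite reflK.
Qed.

(** The matching step.  The increment of the free trace-back splits along
   w, Q y and the velocities, and only the w part uses the compatibility
   condition. *)
Lemma compat_glue q : unhit q -> reflected q ->
  compat_at D0 (hit q.1.2 q.2) q.2 -> forall h : tphase,
  D0 (alpha q) (slope_alpha q q h) =
  D0 (alpha (beta q)) (slope_alpha (beta q) (beta q) (slope_beta q q h)).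
Proof.
move=> uq rq; have v0 := reflected_moving rq; have [[t0 xv] tT] := rq.
have ET : q.1.1 = fine (t_b q.1.2 q.2).
  have := uq.2; move: tT; rewrite t_bE // !lee_fin => h1 h2.
  by apply/eqP; rewrite eq_le h1 h2.
have z1 := hit_unit xv v0; have zv := hit_vel xv v0.
have zv0 : dot (hit q.1.2 q.2) q.2 != 0 by rewrite lt_eqF.
move=> /(compat_transport_datum z1 zv0) C h.
have Ea : alpha q = (hit q.1.2 q.2, q.2) by rewrite /alpha ET.
have Eb : alpha (beta q) = (hit q.1.2 q.2, reflmx (hit q.1.2 q.2) *m q.2).
  by rewrite /alpha /beta /= -ET subrr scale0r subr0.
rewrite Ea Eb.
have /= -> := reflected_differential z1 zv0 (fun k => specular_vel q.2 k z1)
  (specular_tan q.2 z1) C (h.1.2 - q.1.1 *: h.2 - h.1.1 *: q.2) h.2.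
congr (D0 _ _); rewrite /slope_alpha /slope_beta /slope_hit /slope_T /beta /=.
rewrite -ET subrr scale0r subr0.
move: z1 zv0; move: (h.1.2 - q.1.1 *: h.2) => dx.
move: (hit q.1.2 q.2) => y; move: h.1.1 h.2 q.2 => dt dv w y1 yw.
have -> : dot (y + y) dx / dot (y + y) w = dot y dx / dot y w.
  by rewrite !dotD; field; rewrite yw -mulr2n -mulr_natl mulf_neq0.
rewrite !reflE.
have -> : dot y (dx - dt *: w) / dot y w = dot y dx / dot y w - dt.
  by rewrite dotDr dotNr dotZr; field.
set c := dot y dx / dot y w.
have Ec : dot y dx = c * dot y w by rewrite /c divfK.
congr pair.
  rewrite dotDr dotNr dotZr Ec.
  by apply: vec2P; rewrite !mxE; ring.
rewrite !(dotDl, dotNl, dotZl).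
by apply: vec2P; rewrite !mxE; ring.
Qed.

End SpecularDerivatives.

(** * Gluing across the collision times *)

Section Gluing.
Context {R : realType}.
Local Notation vec := 'cV[R]_2.
Local Notation phase := (vec * vec)%type.
Local Notation tphase := (R * vec * vec)%type.
Implicit Types (x v w y a b : vec) (s t : R) (p q : tphase).

Lemma fin_coords_tphase : fin_coords tphase.
Proof.
apply: fin_coords_prod; last exact: fin_coords_cV.
by apply: fin_coords_prod; [exact: fin_coords_real|exact: fin_coords_cV].
Qed.

Lemma alpha_phase_bar q : unhit q -> phase_bar (alpha q).
Proof.
move=> [[t0 xv] tT]; split=> //=; apply/closure_OmegaE.
have [x1 _] := (phase_IE _ _).1 xv.
have [v0|v0] := eqVneq q.2 0; first by rewrite v0 scaler0 subr0.
move: t0; rewrite le_eqVlt => /predU1P [<-|t0]; first by rewrite scale0r subr0.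
by rewrite (ray_le xv v0 t0); move: tT; rewrite t_bE.
Qed.

Lemma unhit_inside q : time_I q ->
  dot (alpha q).1 (alpha q).1 <= 1 -> unhit q.
Proof.
move=> Iq; have [t0 xv] := Iq; split=> //.
have [v0|v0] := eqVneq q.2 0; first by rewrite v0 t_b_at_rest ?leey // -v0.
rewrite t_bE // lee_fin.
move: t0; rewrite le_eqVlt => /predU1P [<-|t0]; first exact: tau_ge0.
by rewrite -(ray_le xv v0 t0).
Qed.

(** For moving particles this is the continuity of the exit time; for
   particles at rest, where the exit time is infinite, it is the openness of the
   disk. *)
Lemma unhit_near p : time_I p -> (p.1.1%:E < t_b p.1.2 p.2)%E ->
  \forall q \near within time_I (nbhs p), unhit q.
Proof.
move=> Ip H; have [t0 xv] := Ip.
have C : id @ within time_I (nbhs p) --> p by exact: cvg_within.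
have [v0|v0] := eqVneq p.2 0.
  have x1 : dot (alpha p).1 (alpha p).1 < 1.
    rewrite /alpha /= v0 scaler0 subr0 lt_neqAle.
    have [-> N] := (phase_IE _ _).1 xv; rewrite andbT; apply/eqP => /N.
    by rewrite v0 dotC dot0l eqxx.
  have Ca : (alpha q).1 @[q --> within time_I (nbhs p)] --> (alpha p).1.
    apply: cvgB; first exact: cvg_pos C.
    by apply: cvgZ; [exact: cvg_time C|exact: cvg_vel C].
  have N := cvgr_lt _ (cvg_dot _ Ca Ca) _ x1.
  near=> q; apply: unhit_inside; first by near: q; exact: withinT.
  by apply: ltW; near: q; exact: N.
have HT : p.1.1 < fine (t_b p.1.2 p.2) by move: H; rewrite t_bE.
have S0 : 0 < fine (t_b p.1.2 p.2) - p.1.1 by rewrite subr_gt0.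
have Cd : fine (t_b q.1.2 q.2) - q.1.1 @[q --> within time_I (nbhs p)] -->
    fine (t_b p.1.2 p.2) - p.1.1.
  by apply: cvgB; [exact: cvg_T|exact: cvg_time C].
have N := cvgr_gt _ Cd _ S0.
near=> q.
have Iq : time_I q by near: q; exact: withinT.
have vq : q.2 != 0 by near: q; exact: moving_near.
have : 0 < fine (t_b q.1.2 q.2) - q.1.1 by near: q; exact: N.
rewrite subr_gt0 => h; split; first exact: Iq.
by have [_ xvq] := Iq; move: h; rewrite t_bE // lee_fin => /ltW.
Unshelve. all: by end_near. Qed.

Lemma reflected_near p : time_I p -> (t_b p.1.2 p.2 < p.1.1%:E)%E ->
  \forall q \near within time_I (nbhs p), reflected q.
Proof.
move=> Ip H; have [t0 xv] := Ip.
have C : id @ within time_I (nbhs p) --> p by exact: cvg_within.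
have v0 : p.2 != 0 by apply: reflected_moving; split=> //; exact: ltW.
have S0 : fine (t_b p.1.2 p.2) - p.1.1 < 0.
  by rewrite subr_lt0; move: H; rewrite t_bE.
have Cd : fine (t_b q.1.2 q.2) - q.1.1 @[q --> within time_I (nbhs p)] -->
    fine (t_b p.1.2 p.2) - p.1.1.
  by apply: cvgB; [exact: cvg_T|exact: cvg_time C].
have N := cvgr_lt _ Cd _ S0.
near=> q.
have Iq : time_I q by near: q; exact: withinT.
have vq : q.2 != 0 by near: q; exact: moving_near.
have : fine (t_b q.1.2 q.2) - q.1.1 < 0 by near: q; exact: N.
rewrite subr_lt0 => h; split; first exact: Iq.
by have [_ xvq] := Iq; move: h; rewrite t_bE // lee_fin => /ltW.
Unshelve. all: by end_near. Qed.

Variables (f0 : phase -> R) (D0 : phase -> {linear phase -> R}).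
Hypotheses (f0_C1 : is_C1_on phase_bar f0 D0) (f0_spec : specular0 f0).
Local Notation f := (transport_sol f0).

Definition free_diff q : {linear tphase -> R} :=
  D0 (alpha q) \o slope_alpha q q.

Lemma C1_unhit p : unhit p -> C1_near unhit f free_diff p.
Proof.
move=> up.
have C : id @ within unhit (nbhs p) --> p by exact: cvg_within.
apply: (@C1_near_eq _ _ _ _ (f0 \o alpha) _ free_diff) => //.
  by move=> q uq; rewrite sol_unhit.
apply: (@C1_near_comp _ _ _ phase_bar _ _ _ alpha
  (fun p q => slope_alpha p q : {linear tphase -> phase})) => //.
- exact: fin_coords_phase.
- exact: fin_coords_tphase.
- exact: alpha_phase_bar.
- by near=> q; exact: alpha_slope.
- move=> h; rewrite /slope_alpha /=; apply: cvg_pair_nbhs; last exact: cvg_cst.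
  apply: cvgB; last exact: cvg_cst.
  apply: cvgB; first exact: cvg_cst.
  by apply: cvgZ; [exact: cvg_time C|exact: cvg_cst].
- move=> h; rewrite /slope_alpha /=; apply: cvg_pair_nbhs; last exact: cvg_cst.
  apply: cvgB; last by apply: cvgZ; [exact: cvg_cst|exact: cvg_vel C].
  apply: cvgB; first exact: cvg_cst.
  by apply: cvgZ; [exact: cvg_time C|exact: cvg_cst].
- by apply: datum_C1_near => //; exact: alpha_phase_bar.
Unshelve. all: by end_near. Qed.

Lemma C1_reflected Df p : reflected p -> C1_near time_I f Df (beta p) ->
  C1_near reflected f (fun q => Df (beta q) \o slope_beta q q) p.
Proof.
move=> rp H.
have C : id @ within reflected (nbhs p) --> p by exact: cvg_within.
apply: (@C1_near_eq _ _ _ _ (f \o beta) _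
  (fun q => Df (beta q) \o slope_beta q q)) => //.
  by move=> q rq; exact: sol_beta.
apply: (@C1_near_comp _ _ _ time_I _ _ _ beta
  (fun p q => slope_beta p q : {linear tphase -> tphase})) => //.
- exact: fin_coords_tphase.
- exact: fin_coords_tphase.
- exact: beta_time_I.
- exact: beta_slope_near.
- move=> h; apply: (@cvg_slope_beta _ _ rp (fun _ => p)); exact: cvg_cst.
- move=> h; apply: (@cvg_slope_beta _ _ rp id); first exact: cvg_vel C.
  exact: cvg_Z.
Qed.

(** The differential that the chain rule for f = f o beta imposes.  The number
   of bounces serves as the recursion argument, since [beta] decreases nothing
   structurally. *)
Fixpoint bounce_diff n q : {linear tphase -> R} :=
  if n is m.+1 then bounce_diff m (beta q) \o slope_beta q q else free_diff q.

Definition sol_diff q := bounce_diff (nbounces q) q.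

Lemma sol_diff_beta q : reflected q ->
  forall h, sol_diff q h = sol_diff (beta q) (slope_beta q q h).
Proof. by move=> rq h; rewrite /sol_diff (nbouncesS rq). Qed.

Lemma sol_diff_unhit_lt q : time_I q -> (q.1.1%:E < t_b q.1.2 q.2)%E ->
  sol_diff q = free_diff q.
Proof. by move=> Iq H; rewrite /sol_diff nbounces0. Qed.

Hypothesis compat : compat_on gamma_minus D0.

Lemma compat_hit x v : phase_I (x, v) -> v != 0 -> compat_at D0 (hit x v) v.
Proof.
move=> xv v0; apply: compat; split; first exact/bOmegaE/hit_unit.
by rewrite /nvec /= dotC hit_vel.
Qed.

Lemma beta_unhit_lt q : unhit q -> reflected q ->
  time_I (beta q) /\ ((beta q).1.1%:E < t_b (beta q).1.2 (beta q).2)%E.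
Proof.
move=> uq rq; split; first exact: beta_time_I.
have v0 := reflected_moving rq; have [[t0 xv] tT] := rq.
have [xv' v0' x1' xv0'] := beta_phase xv v0.
have E : (beta q).1.1 <= 0.
  by have := uq.2; rewrite /= t_bE // lee_fin subr_le0.
rewrite t_bE // lte_fin (le_lt_trans E) // t_b_boundary //.
by rewrite divr_gt0 ?mulr_gt0 // dot_gt0.
Qed.

(** Under the compatibility condition the recursive differential
   equals the free one up to and including the collision time, which is what
   makes it continuous across. *)
Lemma sol_diff_unhit q : unhit q -> forall h, sol_diff q h = free_diff q h.
Proof.
move=> uq h; have [Iq] := uq; rewrite le_eqVlt => /predU1P [E|H]; last first.
  by rewrite sol_diff_unhit_lt.
have rq : reflected q by split=> //; rewrite E.
have [Ib Hb] := beta_unhit_lt uq rq.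
rewrite sol_diff_beta // sol_diff_unhit_lt //.
have C : compat_at D0 (hit q.1.2 q.2) q.2.
  by apply: compat_hit; [case: Iq|exact: reflected_moving].
by have := compat_glue f0_C1 f0_spec uq rq C h => /esym.
Qed.

Lemma sol_C1 : is_C1_on time_I f sol_diff.
Proof.
apply/(is_C1_onP _ _ _ fin_coords_tphase).
have Cu p : unhit p -> C1_near unhit f sol_diff p.
  move=> up; apply: (C1_near_eq up _ _ (C1_unhit up)) => //.
  by move=> q h uq; exact: sol_diff_unhit.
apply: bounce_ind => p Ip.
  by move=> H; apply: C1_near_local (unhit_near Ip H) (Cu _ _); split; rewrite ?ltW.
move=> IH.
have Cr : C1_near reflected f sol_diff p.
  apply: (C1_near_eq Ip _ _ (C1_reflected Ip IH)) => // q h rq.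
  exact: sol_diff_beta.
have [Ip' ] := Ip; rewrite le_eqVlt => /predU1P [E|H]; last first.
  exact: C1_near_local (reflected_near Ip' H) Cr.
have up : unhit p by split=> //; rewrite E.
apply: C1_near_local (C1_near_setU (Cu _ up) Cr).
near=> q.
have Iq : time_I q by near: q; exact: withinT.
by case/orP: (le_total q.1.1%:E (t_b q.1.2 q.2)) => H; [left|right].
Unshelve. all: by end_near. Qed.

(** Moving along the flow changes t and T by the same amount and
   leaves the exit point and velocity fixed; hence the transport equation. *)
Lemma slope_beta_flow q : reflected q -> slope_beta q q (1, q.2, 0) = 0.
Proof.
move=> rq; have v0 := reflected_moving rq; have [[t0 xv] tT] := rq.
have zv0 : dot (hit q.1.2 q.2) q.2 != 0 by rewrite lt_eqF // hit_vel.
have ST : slope_T q q (1, q.2, 0) = 1.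
  rewrite /slope_T /= scaler0 subr0 divff // dotDl -mulr2n -mulr_natl.
  by rewrite mulf_neq0.
have SH : slope_hit q q (1, q.2, 0) = 0.
  by rewrite /slope_hit ST /= scaler0 subr0 scale1r subrr.
rewrite /slope_beta ST SH /= subrr dot0l (dotC _ 0) dot0l addr0 scale0r scaler0.
by rewrite addr0 scaler0 subr0.
Qed.

Lemma tpart_flow (D : tphase -> {linear tphase -> R}) p w :
  tpart_t D p + (tgrad_x D p *m w) 0 0 = D p (1, w, 0).
Proof.
have -> : (tgrad_x D p *m w) 0 0 = D p (0, w, 0).
  have -> : (0, w, 0) = \sum_i w i 0 *: (0, delta_mx i 0, 0) :> tphase.
    rewrite {1}(cV_sum_delta w).
    rewrite -[(0, _)]sum_pairr -[LHS]sum_pairl; apply: eq_bigr => i _.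
    by congr (_, _, _); rewrite /= scaler0.
  rewrite linear_sum mxE; apply: eq_bigr => i _.
  by rewrite linearZ mxE [RHS]mulrC.
by rewrite /tpart_t -linearD; congr (D p _); congr (_, _, _);
  rewrite /= ?addr0 ?add0r.
Qed.

Lemma sol_is_solution : C1_solution f0 f.
Proof.
split.
- exists sol_diff; first exact: sol_C1.
  move=> t x v t0 Ox; rewrite tpart_flow.
  have Iq : time_I (t, x, v).
    split=> //; apply/phase_IE; move/OmegaE: Ox => x1; split; first exact: ltW.
    by move=> e; rewrite e ltxx in x1.
  case/orP: (le_total t%:E (t_b x v)) => H.
    rewrite sol_diff_unhit // /free_diff /= /slope_alpha /=.
    rewrite scaler0 subr0 scale1r subrr; exact: linear0.
  have rq : reflected (t, x, v) by [].
  by rewrite sol_diff_beta // slope_beta_flow // linear0.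
- have incoming t x v : 0 <= t -> phase_I (x, v) -> dot x x = 1 ->
      dot x v < 0 -> f (t, x, v) = f (t, x, reflmx x *m v).
    move=> t0 xv x1 xv0.
    have v0 : v != 0.
      by apply/eqP => v0; rewrite v0 dotC dot0l ltxx in xv0.
    have T0 : t_b x v = 0%E.
      rewrite t_bE // /tau /disc x1 subrr mul0r addr0 sqrtr_sqr ltr0_norm //.
      by rewrite subrr mul0r.
    rewrite sol_beta; first by rewrite /beta /hit /= T0 /= scale0r !subr0.
    by split=> //; rewrite /= T0 lee_fin.
  move=> t x v t0 xv /bOmegaE x1.
  have [_ /(_ x1) ] := (phase_IE _ _).1 xv; rewrite neq_lt => /orP[|] xv0.
    exact: incoming.
  rewrite [RHS]incoming ?reflK //.
    apply/phase_IE; rewrite x1 lexx; split=> // _.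
    by rewrite dot_refl // oppr_eq0 gt_eqF.
  by rewrite dot_refl // oppr_lt0.
- move=> x v xv; rewrite sol_unhit //; first by rewrite /alpha /= scale0r subr0.
  by split=> //=; exact: t_b_ge0.
Qed.
End Gluing.

(** * Uniqueness *)

Section Main.
Context {R : realType}.
Local Notation vec := 'cV[R]_2.
Local Notation phase := (vec * vec)%type.
Local Notation tphase := (R * vec * vec)%type.
Implicit Types (x v w y a b : vec) (s t r : R) (p q : tphase).

(** The exit is transversal, so the closed segment meets no grazing point. *)
Lemma ray_time_I q r : time_I q -> 0 <= r <= q.1.1 ->
  (r%:E <= t_b q.1.2 q.2)%E -> time_I (q.1.1 - r, q.1.2 - r *: q.2, q.2).
Proof.
move=> [t0 xv] /andP[r0 rt] rT; split; first by rewrite /= subr_ge0.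
move: r0; rewrite le_eqVlt => /predU1P [<-|r0] /=; first by rewrite scale0r subr0.
have [v0|v0] := eqVneq q.2 0; first by rewrite v0 scaler0 subr0 -v0.
move: rT; rewrite t_bE // lee_fin => rT; apply/phase_IE; split.
  by rewrite (ray_le xv v0 r0).
move: rT; rewrite le_eqVlt => /predU1P [->|rT].
  by move=> _; rewrite -hitE // lt_eqF // hit_vel.
by move: rT; rewrite -(ray_lt xv v0 r0) => h e; rewrite e ltxx in h.
Qed.

Lemma ray_Omega x v r : phase_I (x, v) -> 0 < r ->
  (r%:E < t_b x v)%E -> Omega (x - r *: v).
Proof.
move=> xv r0 rT; apply/OmegaE.
have [v0|v0] := eqVneq v 0; last first.
  by move: rT; rewrite t_bE // lte_fin (ray_lt xv v0 r0).
rewrite v0 scaler0 subr0 lt_neqAle; have [-> N] := (phase_IE _ _).1 xv.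
by rewrite andbT; apply/eqP => /N; rewrite v0 dotC dot0l eqxx.
Qed.

Lemma is_derive_line (V : normedModType R) (S : set V) (f : V -> R) (p : V)
    (L : {linear V -> R}) (k : V) (g : R -> R) r : fin_coords V ->
  diff_at S f p L -> (forall s, g (s + r) = f (p + s *: k)) ->
  (\forall s \near (0 : R), S (p + s *: k)) ->
  is_derive r 1 g (L k).
Proof.
move=> FV d gE Sk.
have s0 : (s : R) @[s --> 0^'] --> (0 : R) by exact: cvg_within.
have sn0 : \forall s \near (0 : R)^', s != 0 by exact: nbhs_dnbhs_neq.
have Sk' : \forall s \near (0 : R)^', S (p + s *: k).
  by apply: cvg_within.
have C : s^-1 * (f (p + s *: k) - f p) @[s --> (0 : R)^'] --> L k.
  exact: diff_at_curve s0 sn0 FV d (cvg_cst k) Sk'.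
have C' : h^-1 *: ((g \o shift r) (h *: (1 : R)) - g r) @[h --> (0 : R)^'] --> L k.
  apply: cvg_trans C; apply: near_eq_cvg; near=> s => /=.
  rewrite -{2}(add0r r) !gE scale0r addr0.
  by rewrite -[s *: 1]/(s * 1) mulr1.
apply: DeriveDef; first by apply/cvg_ex; exists (L k).
exact: cvg_lim C'.
Unshelve. all: by end_near. Qed.

Section Uniqueness.
Variables (f0 : phase -> R) (g : tphase -> R).
Hypothesis g_sol : C1_solution f0 g.

Lemma solution_ray q r : time_I q -> 0 <= r <= q.1.1 ->
  (r%:E <= t_b q.1.2 q.2)%E -> g (q.1.1 - r, q.1.2 - r *: q.2, q.2) = g q.
Proof.
case: q => [[t x] v] /= Iq /andP[r0 rt] rT.
have [[Dg gC1 gflow] _ _] := g_sol.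
move/(is_C1_onP _ _ _ fin_coords_tphase): gC1 => gC1.
pose P s : tphase := (t - s, x - s *: v, v).
have PI s : 0 <= s <= r -> time_I (P s).
  move=> /andP[s0 sr]; apply: (@ray_time_I (t, x, v)) => //=.
    by rewrite s0 (le_trans sr).
  by apply: le_trans rT; rewrite lee_fin.
have Pline s u : P (s + u) = P u + s *: (- 1, - v, 0).
  congr (_, _, _) => /=; last by rewrite scaler0 addr0.
  - by rewrite -[s *: -1]/(s * -1); ring.
  - by rewrite scalerDl; apply: vec2P; rewrite !mxE; ring.
have Pc u : P s @[s --> u] --> P u.
  apply: cvg_pair_nbhs; last exact: cvg_cst.
  apply: cvg_pair_nbhs; first by apply: cvgB; [exact: cvg_cst|exact: cvg_id].
  apply: cvgB; first exact: cvg_cst.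
  by apply: cvgZ; [exact: cvg_id|exact: cvg_cst].
(* The segment may be reduced to a point; the mean value theorem needs 0 < r. *)
move: r0; rewrite le_eqVlt => /predU1P [<-|r0]; first by rewrite subr0 scale0r subr0.
have D s : s \in `]0, r[%R -> is_derive s 1 (g \o P) 0.
  rewrite in_itv /= => /andP[s0 sr].
  have Is : time_I (P s) by apply: PI; rewrite !ltW.
  have -> : (0 : R) = Dg (P s) (- 1, - v, 0).
    have /= := gflow (t - s) (x - s *: v) v (proj1 Is).
    rewrite tpart_flow => H.
    have -> : (- 1, - v, 0) = - (1, v, 0) :> tphase.
      by congr (_, _, _); rewrite /= oppr0.
    rewrite linearN H ?oppr0 //.
    apply: ray_Omega => //; first exact: (proj2 Iq).
    by apply: lt_le_trans rT; rewrite lte_fin.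
  apply: (@is_derive_line _ time_I g (P s)) => //.
  - exact: fin_coords_tphase.
  - exact: (gC1 _ Is).1.
  - by move=> u; rewrite /= Pline.
  - have C : u + s @[u --> (0 : R)] --> s.
      rewrite -[X in _ --> X]add0r.
      by apply: cvgD; [exact: cvg_id|exact: cvg_cst].
    have N1 := cvgr_gt _ C _ s0; have N2 := cvgr_lt _ C _ sr.
    near=> u; rewrite -Pline; apply: PI.
    by apply/andP; split; apply: ltW; near: u; [exact: N1|exact: N2].
have C : {within `[0, r], continuous (g \o P)}.
  apply/subspace_continuousP => s; rewrite /= in_itv /= => sr.
  have Is := PI _ sr.
  have Gc := diff_at_cvg fin_coords_tphase (gC1 _ Is).1.
  apply: (@cvg_comp _ _ _ P g _ (within time_I (nbhs (P s)))) Gc.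
  move=> A HA; have := Pc s _ HA.
  apply: (@filterS _ (nbhs s)) => u /= H; rewrite in_itv /= => ur.
  exact/H/PI.
have [c _] := MVT r0 D C.
rewrite mul0r => /eqP; rewrite subr_eq0 => /eqP /= ->.
by rewrite /P subr0 scale0r subr0.
Unshelve. all: by end_near. Qed.

Hypothesis f0_spec : specular0 f0.

Lemma solution_unique q : time_I q -> g q = transport_sol f0 q.
Proof.
have [_ gbc gic] := g_sol.
move: q; apply: bounce_ind => q.
  move=> Iq H; have t0 := proj1 Iq.
  have tt : 0 <= q.1.1 <= q.1.1 by rewrite t0 lexx.
  rewrite sol_unhit_lt // -(solution_ray Iq tt (ltW H)).
  have [_ h] := ray_time_I Iq tt (ltW H).
  by rewrite subrr gic.
move=> rq IH; have v0 := reflected_moving rq; have [[t0 xv] tT] := rq.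
have tbE := t_bE xv v0.
have Tt : 0 <= fine (t_b q.1.2 q.2) <= q.1.1.
  by move: tT; rewrite tbE lee_fin => ->; rewrite andbT tau_ge0.
have TT : ((fine (t_b q.1.2 q.2))%:E <= t_b q.1.2 q.2)%E by rewrite tbE.
rewrite sol_beta // -IH -(solution_ray (proj1 rq) Tt TT).
have [h1 h2] := ray_time_I (proj1 rq) Tt TT.
by rewrite gbc //; exact/bOmegaE/hit_unit.
Qed.
End Uniqueness.
End Main.

(** * Time derivatives at a collision and the main theorem *)

Section NonSmooth.
Context {R : realType}.
Local Notation vec := 'cV[R]_2.
Local Notation phase := (vec * vec)%type.
Local Notation tphase := (R * vec * vec)%type.
Implicit Types (x v w y a b : vec) (s t r : R) (p q : tphase) (k : nat).

Lemma iter_beta_phase k q : phase_I (q.1.2, q.2) -> q.2 != 0 ->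
  phase_I ((iter k beta q).1.2, (iter k beta q).2) /\ (iter k beta q).2 != 0.
Proof.
move=> xv v0; elim: k => [|k [IH1 IH2]] //=.
by have [h1 h2 _ _] := beta_phase IH1 IH2.
Qed.

Lemma cycle_iter_beta k q : phase_I (q.1.2, q.2) -> q.2 != 0 ->
  cycle_ k q.1.1 q.1.2 q.2 =
  ((iter k beta q).1.1%:E, (iter k beta q).1.2, (iter k beta q).2).
Proof.
elim: k q => [|k IH] q xv v0 //.
have [xv' v0' _ _] := beta_phase xv v0.
by rewrite cycle_beta // IH // iterSr.
Qed.

Lemma iter_beta_time_le k q : (iter k beta q).1.1 <= q.1.1.
Proof.
elim: k => [|k IH] //=; apply: le_trans IH.
by rewrite lerBlDr lerDl fine_ge0 // t_b_ge0.
Qed.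

(** Shifting the time only.  It commutes with bounces, since the exit time does
   not depend on t, and thus reaches the last collision unchanged. *)
Definition delay s q : tphase := (q.1.1 + s, q.1.2, q.2).

Lemma delayE s q : delay s q = q + s *: (1, 0, 0).
Proof.
case: q => [[t x] v]; congr (_, _, _); rewrite /= ?scaler0 ?addr0 //.
by rewrite -[s *: 1]/(s * 1) mulr1.
Qed.

Lemma delay_time_I s q : time_I q -> 0 <= q.1.1 + s -> time_I (delay s q).
Proof. by move=> [_ xv] ts; split. Qed.

Lemma beta_delay s q : beta (delay s q) = delay s (beta q).
Proof. by rewrite /beta /delay /= addrAC. Qed.

Variables (f0 : phase -> R) (D0 : phase -> {linear phase -> R}).
Hypotheses (f0_C1 : is_C1_on phase_bar f0 D0) (f0_spec : specular0 f0).
Local Notation f := (transport_sol f0).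

Lemma sol_delay k q s : phase_I (q.1.2, q.2) -> q.2 != 0 ->
  0 <= (iter k beta q).1.1 + s -> f (delay s q) = f (delay s (iter k beta q)).
Proof.
elim: k q => [|k IH] q xv v0 // ts.
have [xv' v0' _ _] := beta_phase xv v0.
rewrite iterSr in ts *; rewrite -IH // -beta_delay.
have ts' : 0 <= (beta q).1.1 + s.
  by apply: le_trans ts _; rewrite lerD2r iter_beta_time_le.
apply: sol_beta; split; first split=> //=.
  by apply: le_trans ts' _; rewrite lerD2r (iter_beta_time_le 1).
move: ts'; rewrite /delay /= t_bE // lee_fin.
by rewrite addrAC subr_ge0.
Qed.

Section AtBounce.
Variables (q : tphase) (k : nat) (U : set tphase) (L : {linear tphase -> R}).
Let r := iter k beta q.
Local Notation y := (hit r.1.2 r.2).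
Local Notation w := r.2.
Local Notation S := (time_I `&` U).
Hypotheses (Iq : time_I q) (v0 : q.2 != 0) (Uq : nbhs q U).
Hypothesis bounce_time : r.1.1 = fine (t_b r.1.2 r.2).
Hypothesis qL : diff_at S f q L.

Let xv : phase_I (q.1.2, q.2) := proj2 Iq.
Let rxv : phase_I (r.1.2, r.2). Proof. by have [] := iter_beta_phase k xv v0. Qed.
Let rv0 : r.2 != 0. Proof. by have [] := iter_beta_phase k xv v0. Qed.
Let y1 : dot y y = 1. Proof. exact: hit_unit. Qed.

Let U_near (h : tphase) : \forall s \near (0 : R)^'+, U (q + s *: h).
Proof.
have C : q + s *: h @[s --> (0 : R)^'+] --> q.
  rewrite -[X in _ --> X]addr0 -[X in _ + X](scale0r h).
  apply: cvgD; first exact: cvg_cst.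
  by apply: cvgZ; [exact: cvg_within|exact: cvg_cst].
exact: C.
Qed.

Let r_time_ge0 : 0 <= r.1.1.
Proof. by rewrite bounce_time fine_ge0 // t_b_ge0. Qed.

Let r_unhit s : 0 <= r.1.1 + s -> s <= 0 -> unhit (delay s r).
Proof.
move=> rs s0; split; first by [].
by rewrite /delay /= bounce_time t_bE // lee_fin /= gerDl.
Qed.

Let f_before s : 0 <= r.1.1 + s -> s <= 0 -> f (delay s q) = f0 (y - s *: w, w).
Proof.
move=> rs s0; rewrite (@sol_delay k) // sol_unhit //; last exact: r_unhit.
congr (f0 _); congr pair => /=.
by rewrite bounce_time /hit scalerDl opprD addrA.
Qed.

Let fq : f q = f0 (y, w).
Proof.
have := @f_before 0; rewrite addr0 scale0r subr0 => <- //.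
by rewrite delayE scale0r addr0.
Qed.

Lemma derivative_after : L (1, 0, 0) = - D0 (y, reflmx y *m w) (reflmx y *m w, 0).
Proof.
have [bxv bv0 b1 bv] := beta_phase rxv rv0.
have T0 : 0 < tau y (reflmx y *m w).
  by rewrite t_b_boundary // divr_gt0 ?mulr_gt0 // dot_gt0.
have bt : (beta r).1.1 = 0 by rewrite /= bounce_time subrr.
have Ed s : delay s (beta r) = (s, y, reflmx y *m w).
  by rewrite /delay bt add0r.
have un s : 0 < s -> s < tau y (reflmx y *m w) -> unhit (delay s (beta r)).
  move=> s0 sT; rewrite Ed; split; first by split=> //; exact: ltW.
  by rewrite /= t_bE // lee_fin ltW.
have Ea s : alpha (delay s (beta r)) =
    (y, reflmx y *m w) + s *: (- (reflmx y *m w), 0).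
  rewrite Ed /alpha; congr pair; rewrite /= ?scalerN //.
  by rewrite scaler0 addr0.
rewrite -linearN.
have -> : - (reflmx y *m w, 0) = (- (reflmx y *m w), 0) :> phase.
  by congr pair; rewrite /= oppr0.
apply: (@diff_at_curve_eq _ _ _ S phase_bar f f0 q (y, reflmx y *m w)
  _ _ (fun _ => (1, 0, 0)) (fun _ => (- (reflmx y *m w), 0))) => //.
- exact: fin_coords_tphase.
- exact: fin_coords_phase.
- by apply: (datum_C1_near f0_C1 _).1; exact: phase_bar_unit.
- exact: cvg_cst.
- exact: cvg_cst.
- near=> s; split; last by near: s; exact: U_near.
  rewrite -delayE; apply: delay_time_I => //; apply: addr_ge0 (proj1 Iq) _.
  by apply: ltW; near: s; exact: nbhs_right_gt.
- near=> s; rewrite -Ea; apply: alpha_phase_bar; apply: un.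
    by near: s; exact: nbhs_right_gt.
  by near: s; exact: nbhs_right_lt.
- near=> s.
  have s0 : 0 < s by near: s; exact: nbhs_right_gt.
  have sT : s < tau y (reflmx y *m w) by near: s; exact: nbhs_right_lt.
  have sk : f (delay s q) = f (delay s (beta r)).
    apply: (@sol_delay k.+1) => //.
    by rewrite [iter _ _ _]/(beta r) bt add0r ltW.
  rewrite -delayE sk sol_unhit //; last exact: un.
  by rewrite Ea fq [f0 (y, w)]f0_spec //; apply/bOmegaE.
Unshelve. all: by end_near. Qed.

Let after_bounce_moves : (0 < k)%N -> 0 < fine (t_b r.1.2 r.2).
Proof.
rewrite /r; case: k => // j _.
have [jxv jv0] := iter_beta_phase j xv v0.
have [bxv bv0 b1 bv] := beta_phase jxv jv0.
rewrite [iter _ _ _]/(beta (iter j beta q)) t_bE // t_b_boundary //.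
by rewrite divr_gt0 ?mulr_gt0 // dot_gt0.
Qed.

Lemma derivative_before : 0 < q.1.1 -> L (1, 0, 0) = - D0 (y, w) (w, 0).
Proof.
move=> t0.
have T0 : 0 < r.1.1.
  have [k0|k0] := posnP k; first by rewrite /r k0.
  by rewrite bounce_time after_bounce_moves.
rewrite -[LHS]opprK; congr (- _); rewrite -linearN.
apply: (@diff_at_curve_eq _ _ _ S phase_bar f f0 q (y, w)
  _ _ (fun _ => - (1, 0, 0)) (fun _ => (w, 0))) => //.
- exact: fin_coords_tphase.
- exact: fin_coords_phase.
- by apply: (datum_C1_near f0_C1 _).1; exact: phase_bar_unit.
- exact: cvg_cst.
- exact: cvg_cst.
- near=> s; split; last by near: s; exact: U_near.
  rewrite scalerN -scaleNr -delayE; apply: delay_time_I => //; rewrite subr_ge0.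
  by apply: ltW; near: s; exact: nbhs_right_lt.
- near=> s.
  have -> : (y, w) + s *: (w, 0) = alpha (delay (- s) r).
    rewrite /alpha /delay /= bounce_time; congr pair => /=.
      by rewrite /hit scalerDl scaleNr opprD opprK addrA.
    by rewrite scaler0 addr0.
  apply: alpha_phase_bar; apply: r_unhit.
    by rewrite subr_ge0; apply: ltW; near: s; exact: nbhs_right_lt.
  by rewrite oppr_le0; apply: ltW; near: s; exact: nbhs_right_gt.
- near=> s.
  rewrite scalerN -scaleNr -delayE fq f_before.
  + congr (f0 _ - _); congr pair => /=; last by rewrite scaler0 addr0.
    by rewrite scaleNr opprK.
  + by rewrite subr_ge0; apply: ltW; near: s; exact: nbhs_right_lt.
  + by rewrite oppr_le0; apply: ltW; near: s; exact: nbhs_right_gt.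
Unshelve. all: by end_near. Qed.

(** At t = 0 the point is incoming on the boundary.  Moving
   inwards along v at time 0 gives the derivative of [f0], moving along the flow
   gives 0, and the time direction is the difference of the two. *)
Lemma derivative_initial : q.1.1 = 0 -> L (1, 0, 0) = - D0 (y, w) (w, 0).
Proof.
move=> t0.
have k0 : k = 0%N.
  apply/eqP; rewrite -leqn0 leqNgt; apply/negP => /after_bounce_moves.
  rewrite -bounce_time => /lt_le_trans /(_ (iter_beta_time_le k q)).
  by rewrite t0 ltxx.
have Er : r = q by rewrite /r k0.
have Ey : y = q.1.2 by rewrite /hit -bounce_time Er t0 scale0r subr0.
have qE : q = (0, q.1.2, q.2) by move: t0; case: q => [[t x] v] /= ->.
have yw : dot q.1.2 q.2 < 0 by have := hit_vel rxv rv0; rewrite Ey Er.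
have x1 : dot q.1.2 q.1.2 = 1 by rewrite -Ey.
have inside : \forall s \near (0 : R)^'+, 0 < s /\
    dot (q.1.2 + s *: q.2) (q.1.2 + s *: q.2) < 1.
  have ww : 0 < dot q.2 q.2 by rewrite dot_gt0.
  near=> s; have s0 : 0 < s by near: s; exact: nbhs_right_gt.
  have sc : s < - dot q.1.2 q.2 / dot q.2 q.2.
    by near: s; apply: nbhs_right_lt; rewrite divr_gt0 ?oppr_gt0.
  split=> //; rewrite !dotD x1 (dotC q.2 q.1.2).
  by rewrite ltr_pdivlMr // in sc; nra.
have inI s x : dot x x < 1 -> 0 <= s -> time_I (s, x, q.2).
  move=> h s0; split=> //; apply/phase_IE; split; first exact: ltW.
  by move=> e; rewrite e ltxx in h.
have E1 s : q + s *: (0, q.2, 0) = (0, q.1.2 + s *: q.2, q.2).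
  by rewrite {1}qE; congr (_, _, _); rewrite /= ?scaler0 ?addr0.
have E2 s : q + s *: (1, q.2, 0) = (s, q.1.2 + s *: q.2, q.2).
  rewrite {1}qE; congr (_, _, _); rewrite /= ?scaler0 ?addr0 //.
  by rewrite add0r -[s *: 1]/(s * 1) mulr1.
have bar : diff_at phase_bar f0 (y, w) (D0 (y, w)).
  by apply: (datum_C1_near f0_C1 _).1; exact: phase_bar_unit.
have L1 : L (0, q.2, 0) = D0 (y, w) (w, 0).
  apply: (@diff_at_curve_eq _ _ _ S phase_bar f f0 q (y, w)
    _ _ (fun _ => (0, q.2, 0)) (fun _ => (w, 0))) => //.
  - exact: fin_coords_tphase.
  - exact: fin_coords_phase.
  - exact: cvg_cst.
  - exact: cvg_cst.
  - near=> s; split; last by near: s; exact: U_near.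
    have [s0 h] : 0 < s /\ dot (q.1.2 + s *: q.2) (q.1.2 + s *: q.2) < 1.
      by near: s.
    by rewrite E1; apply: inI.
  - near=> s; split=> //=; rewrite Ey Er; apply/closure_OmegaE.
    have [s0 h] : 0 < s /\ dot (q.1.2 + s *: q.2) (q.1.2 + s *: q.2) < 1.
      by near: s.
    exact: ltW.
  - near=> s.
    have [s0 h] : 0 < s /\ dot (q.1.2 + s *: q.2) (q.1.2 + s *: q.2) < 1.
      by near: s.
    rewrite fq E1 sol_unhit //; last by split; [exact: inI|exact: t_b_ge0].
    congr (f0 _ - _); rewrite /alpha /= scale0r subr0 Ey Er.
    by congr pair; rewrite /= scaler0 addr0.
have L2 : L (1, q.2, 0) = 0.
  rewrite -(linear0 (D0 (y, w))).
  apply: (@diff_at_curve_eq _ _ _ S phase_bar f f0 q (y, w)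
    _ _ (fun _ => (1, q.2, 0)) (fun _ => 0)) => //.
  - exact: fin_coords_tphase.
  - exact: fin_coords_phase.
  - exact: cvg_cst.
  - exact: cvg_cst.
  - near=> s; split; last by near: s; exact: U_near.
    have [s0 h] : 0 < s /\ dot (q.1.2 + s *: q.2) (q.1.2 + s *: q.2) < 1.
      by near: s.
    by rewrite E2; apply: inI => //; exact: ltW.
  - by near=> s; rewrite scaler0 addr0; exact: phase_bar_unit.
  - near=> s.
    have [s0 h] : 0 < s /\ dot (q.1.2 + s *: q.2) (q.1.2 + s *: q.2) < 1.
      by near: s.
    have Ia : time_I (s, q.1.2 + s *: q.2, q.2) by apply: inI => //; exact: ltW.
    have Ea : alpha (s, q.1.2 + s *: q.2, q.2) = (y, w).
      by rewrite /alpha /= addrK Ey Er.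
    rewrite scaler0 addr0 subrr fq E2 sol_unhit ?Ea ?subrr //.
    by apply: unhit_inside => //; rewrite Ea y1.
have -> : (1, 0, 0) = (1, q.2, 0) - (0, q.2, 0) :> tphase.
  by congr (_, _, _); rewrite /= ?subr0 ?subrr.
by rewrite linearB L2 L1 sub0r.
Unshelve. all: by end_near. Qed.

(** Differentiability forces the time derivatives before and after the
   collision to coincide. *)
Lemma bounce_compat : compat_at D0 y w.
Proof.
apply/(compat_transport_datum f0_C1 f0_spec y1).
  by rewrite lt_eqF // hit_vel.
apply: oppr_inj; rewrite -derivative_after.
have := proj1 Iq; rewrite le_eqVlt => /predU1P [t0|t0].
  by rewrite derivative_initial.
by rewrite derivative_before.
Qed.

End AtBounce.

Lemma not_C1_at_bounce t x v k : time_I (t, x, v) -> t_ k.+1 t x v = 0%E ->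
  ~ compat_at D0 (x_ k.+1 t x v) (v_ k t x v) -> ~ C1_at time_I f (t, x, v).
Proof.
move=> Iq tk0 nc [U Uq [Df fC1]]; apply: nc.
have xv : phase_I (x, v) := proj2 Iq.
have v0 : v != 0.
  apply/eqP => v0; have : (tk k.+1 (t, x, v) <= tk 1 (t, x, v))%E by exact: tk_mono.
  by rewrite {1}/tk tk0 tk1 /= v0 t_b_at_rest // -v0.
have Ck j : cycle_ j t x v = ((iter j beta (t, x, v)).1.1%:E,
    (iter j beta (t, x, v)).1.2, (iter j beta (t, x, v)).2).
  exact: (@cycle_iter_beta j (t, x, v)).
rewrite /x_ /v_ (Ck k) (Ck k.+1).
move/(is_C1_onP _ _ _ fin_coords_tphase): fC1 => /(_ (t, x, v)).
move=> /(_ (conj Iq (nbhs_singleton Uq))) [qL _].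
apply: (bounce_compat Iq v0 Uq _ qL).
move: tk0; rewrite /t_ (Ck k.+1) /= => -[] /eqP.
by rewrite subr_eq0 => /eqP.
Qed.

Lemma exists_not_C1 : ~ compat_on gamma_minus D0 ->
  exists t x v k, [/\ 0 < t, time_I (t, x, v), t_ k.+1 t x v = 0%E &
    ~ C1_at time_I f (t, x, v)].
Proof.
move=> nc.
have [y [w [[/bOmegaE y1]]]] : exists y w, gamma_minus (y, w) /\ ~ compat_at D0 y w.
  apply: contrapT => H; apply: nc => y w g.
  by apply: contrapT => c; apply: H; exists y, w.
rewrite /nvec /= dotC => yw nyw.
have w0 : w != 0 by apply/eqP => e; rewrite e dotC dot0l ltxx in yw.
have ww : 0 < dot w w by rewrite dot_gt0.
(* Half of the time the chord through y in direction w stays in the disk. *)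
pose t := - dot y w / dot w w.
have t0 : 0 < t by rewrite divr_gt0 ?oppr_gt0.
have tw : t * dot w w = - dot y w by rewrite /t divfK // gt_eqF.
have x1 : dot (y + t *: w) (y + t *: w) < 1.
  rewrite !dotD /= in y1 *; rewrite y1 tw (dotC w y); nra.
have xv : phase_I (y + t *: w, w).
  by apply/phase_IE; split; [exact: ltW|move=> e; rewrite e ltxx in x1].
have tbt : t_b (y + t *: w) w = t%:E.
  rewrite t_bE //; congr (_%:E).
  have [c c0] := ray_sign xv w0 t0; rewrite addrK y1 subrr => /esym /eqP.
  by rewrite mulf_eq0 gt_eqF //= subr_eq0 => /eqP.
have Iq : time_I (t, y + t *: w, w) by split=> //; exact: ltW.
have tk : t_ 1 t (y + t *: w) w = 0%E.
  by rewrite /t_ /cycle_ /= tbt subee.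
exists t, (y + t *: w), w, 0%N; split=> //.
apply: (not_C1_at_bounce Iq tk).
by rewrite /x_ /v_ /cycle_ /= tbt /= addrK.
Qed.
End NonSmooth.

Theorem theorem1p3 (R : realType) (f0 : 'cV[R]_2 * 'cV[R]_2 -> R)
    (D0 : 'cV[R]_2 * 'cV[R]_2 -> {linear ('cV[R]_2 * 'cV[R]_2)%type -> R})
    (f0_C1 : is_C1_on phase_bar f0 D0) (f0_specular : specular0 f0) :
  (* (i) *)
  (compat_on gamma_minus D0 ->
     C1_solution f0 (transport_sol f0) /\
     (forall g : R * 'cV[R]_2 * 'cV[R]_2 -> R, C1_solution f0 g ->
        forall (t : R) (x v : 'cV[R]_2), time_I (t, x, v) ->
          g (t, x, v) = transport_sol f0 (t, x, v))) /\
  (* (ii) *)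
  (compat_on gamma_minus D0 -> compat_on gamma_plus D0) /\
  (* (iii) *)
  (~ compat_on gamma_minus D0 ->
     (exists (t : R) (x v : 'cV[R]_2) (k : nat),
        [/\ 0 < t, time_I (t, x, v), t_ k.+1 t x v = 0%E &
          ~ C1_at time_I (transport_sol f0) (t, x, v)]) /\
     (forall (t : R) (x v : 'cV[R]_2) (k : nat),
        time_I (t, x, v) -> t_ k.+1 t x v = 0%E ->
        ~ compat_at D0 (x_ k.+1 t x v) (v_ k t x v) ->
        ~ C1_at time_I (transport_sol f0) (t, x, v))).
Proof.
split; first move=> compat; [split|split].
- exact: (sol_is_solution f0_C1).
- by move=> g g_sol t x v; exact: solution_unique.
- move=> compat y w [/bOmegaE y1]; rewrite /nvec /= dotC => yw.
  rewrite -[w](reflK w y1); apply: (compat_refl f0_C1 f0_specular) => //.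
    by rewrite dot_refl // oppr_eq0 gt_eqF.
  apply: compat; split; first exact/bOmegaE.
  by rewrite /nvec /= dotC dot_refl // oppr_lt0.
- move=> nc; split; first exact: (exists_not_C1 f0_C1).
  by move=> t x v k; exact: (not_C1_at_bounce f0_C1).
Qed.
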